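(* Let $\{a,b,c\}$ be a generating set of a finite abelian group $G$, such that $a+b+c=0$ and the sets $\{\pm a\}$, $\{\pm b\}$, $\{\pm c\}$ are distinct. The Cayley graph $X=\mathrm{Cay}(G;\pm a,\pm b,\pm c)$ is unstable if and only if one of the following conditions is satisfied (perhaps after permuting $a$, $b$, and $c$): (1) $|a|=4$ and $|G|$ is divisible by $8$; (2) $2a=2b$ and $|G|$ is divisible by $8$; (3) $|a|=8$ and $b=3a$; (4) $|a|=12$ and $b=4a$; (5) $|a|=|b|=3$.
   Context: All graphs are simple. For a subset $S$ of an additive abelian group $G$ with $S=-S$ and $0\notin S$, the abelian Cayley graph $\mathrm{Cay}(G;S)$ has vertex set $G$, with $g$ and $h$ adjacent if and only if $g=h+s$ for some $s\in S$. We write $\mathrm{Cay}(G;\pm a,\pm b,\pm c)$ for $\mathrm{Cay}(G;\{a,-a,b,-b,c,-c\})$. $|a|$ denotes the order of the element $a$, and $|G|$ the order of $G$. (Elements of order $2$ among $a,b,c$ are allowed.) The canonical bipartite double cover of a graph $X$ is the graph $BX$ with vertex set $V(X)\times\{0,1\}$ in which $(v,0)$ is adjacent to $(w,1)$ if and only if $v$ is adjacent to $w$ in $X$ (and there are no other edges). The group $\mathrm{Aut}\,X\times S_2$, where $S_2$ is the symmetric group on $\{0,1\}$, is naturally a subgroup of $\mathrm{Aut}\,BX$. The graph $X$ is stable if $\mathrm{Aut}\,BX=\mathrm{Aut}\,X\times S_2$, and unstable otherwise. *)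

(* Defs.v *)
From mathcomp Require Import all_boot all_fingroup all_algebra.

Set Implicit Arguments.
Unset Strict Implicit.
Unset Printing Implicit Defensive.

Import GRing.Theory.
Local Open Scope ring_scope.

(* A simple graph on T is a symmetric irreflexive relation e : rel T; cay_sym
   and cay_irrefl below show that the hypotheses S = -S and 0 \notin S make
   cay S one. *)

Section Graphs.
Variable T : finType.
Implicit Types e : rel T.

Definition graph_aut e : {set {perm T}} :=
  [set p : {perm T} | [forall x, forall y, e (p x) (p y) == e x y]].

Lemma graph_autP e (p : {perm T}) :
  reflect (forall x y, e (p x) (p y) = e x y) (p \in graph_aut e).
Proof.
rewrite inE; apply: (iffP forallP) => [h x y | h x].
  exact/eqP/(forallP (h x)).
by apply/forallP => y; rewrite h.
Qed.

Lemma graph_aut_group_set e : group_set (graph_aut e).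
Proof.
apply/group_setP; split=> [|p q /graph_autP hp /graph_autP hq].
  by apply/graph_autP => x y; rewrite !perm1.
by apply/graph_autP => x y; rewrite !permM hq hp.
Qed.
Canonical graph_aut_group e := Group (graph_aut_group_set e).

(* The layers {0,1} are {false,true}.  For symmetric e this says that (v,0) is
   adjacent to (w,1) iff e v w, with no edge inside a layer. *)
Definition double_cover e : rel (T * bool) :=
  [rel x y | (x.2 != y.2) && e x.1 y.1].

Definition pair_map (p : {perm T}) (s : {perm bool}) (x : T * bool) :=
  (p x.1, s x.2).

Lemma pair_map_inj p s : injective (pair_map p s).
Proof. by move=> [x i] [y j] [] /perm_inj -> /perm_inj ->. Qed.

Definition pair_perm p s : {perm T * bool} := perm (@pair_map_inj p s).

End Graphs.

Definition stable (T : finType) (e : rel T) : bool :=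
  graph_aut (double_cover e) ==
    [set pair_perm p s | p in graph_aut e, s in [set: {perm bool}]].

Definition unstable (T : finType) (e : rel T) : bool := ~~ stable e.

Lemma pair_perm_aut (T : finType) (e : rel T) (p : {perm T}) s :
  p \in graph_aut e -> pair_perm p s \in graph_aut (double_cover e).
Proof.
move=> /graph_autP pe; apply/graph_autP => -[x i] [y j].
by rewrite /double_cover /= !permE /pair_map /= pe (inj_eq perm_inj).
Qed.

Section Cayley.
Variable G : finZmodType.

Definition cay (S : {set G}) : rel G :=
  [rel g h | [exists s in S, g == h + s]].

Lemma cay_sym (S : {set G}) :
  S = [set - s | s in S] -> symmetric (cay S).
Proof.
move=> SN; have SNin s : s \in S -> - s \in S.
  by move=> sS; rewrite SN imset_f.
by move=> g h; apply/exists_inP/exists_inP => -[s sS /eqP->];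
  exists (- s); rewrite ?SNin ?addrK.
Qed.

Lemma cay_irrefl (S : {set G}) : 0 \notin S -> irreflexive (cay S).
Proof.
move=> S0 g; apply/exists_inP => -[s sS /eqP].
by rewrite -[LHS]addr0 => /addrI s0; rewrite s0 sS in S0.
Qed.

Definition cay3 (a b c : G) : rel G := cay [set a; - a; b; - b; c; - c].

End Cayley.

(* Main.v *)
(** An automorphism of the double cover that preserves the two layers is a pair
    (f, g) of permutations of G such that g y - f x lies in the connection set S
    iff y - x does; X is stable iff f = g for all such pairs.

    For generic a, b, c every s + t with s <> t, - t in S has no representation
    as a sum of two elements of S besides s + t and t + s.  The 4-cycles then
    show that f and g act on directions: g (x + s) = f x + s' and
    f (x + s) = g x + s', where s -> s' is a permutation of S commuting with
    negation.  Going around the triangle a + b + c = 0 gives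
    g x = f x + a' + b' + c', so g = f or g = f + 2z with z in S of order 4; in
    the latter case |G| = 4 N with N = |G : <z>|, and N odd is contradictory.

    The remaining triples satisfy, up to permutation, one of 2x = 0, 3x = 0,
    2x = 2y, y = 2x, y = 3x.  A subset A of G is invariant in layer e if all
    pairs preserve the relation y - x \in A between vertices whose layers differ
    by e.  Invariant sets are closed under difference, and so are the level sets
    of the number of representations d = s + t with s, t in two invariant sets.
    In each case a few such steps starting from S isolate {0} in the layer of S,
    which says f = g.  Only for 2x = 2y in a large group this is not enough; there
    the lines in direction z are invariant, and if 8 does not divide |G| such a
    line passes, after an odd number of steps, through the point it started
    from or its translate by x - y. *)
Require Import Defs.
From mathcomp Require Import all_boot all_fingroup all_algebra cyclic.
Set Implicit Arguments.
Unset Strict Implicit.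
Unset Printing Implicit Defensive.

Import GRing.Theory.
Local Open Scope ring_scope.

(** * Linear identities in abelian groups *)

(** Reified linear terms: an identity is proved by comparing the integer coefficients of each atom
    by computation, so multipliers have to be closed numerals. *)
Inductive zexpr :=
  | ZVar of nat | ZZero | ZAdd of zexpr & zexpr | ZOpp of zexpr
  | ZMuln of zexpr & nat | ZMulz of zexpr & int.

Fixpoint zeval (V : zmodType) (env : seq V) (e : zexpr) : V :=
  match e with
  | ZVar i => env`_i
  | ZZero => 0
  | ZAdd e1 e2 => zeval env e1 + zeval env e2
  | ZOpp e1 => - zeval env e1
  | ZMuln e1 n => zeval env e1 *+ n
  | ZMulz e1 n => zeval env e1 *~ n
  end.

Fixpoint zcoef (e : zexpr) (k : nat) : int :=
  match e with
  | ZVar i => (i == k)%:Z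
  | ZZero => 0
  | ZAdd e1 e2 => zcoef e1 k + zcoef e2 k
  | ZOpp e1 => - zcoef e1 k
  | ZMuln e1 n => zcoef e1 k * n%:Z
  | ZMulz e1 n => zcoef e1 k * n
  end.

Lemma zevalE (V : zmodType) (env : seq V) e :
  zeval env e = \sum_(k < size env) env`_k *~ zcoef e k.
Proof.
elim: e => [i||e1 IH1 e2 IH2|e IH|e IH n|e IH n] /=.
- have [lt_i|ge_i] := ltnP i (size env).
    rewrite (bigD1 (Ordinal lt_i)) //= eqxx mulr1z big1 ?addr0 // => k.
    by rewrite -val_eqE /= eq_sym => /negbTE->; rewrite mulr0z.
  rewrite nth_default // big1 // => k _.
  by rewrite gtn_eqF ?mulr0z // (leq_trans (ltn_ord k)).
- by rewrite big1 // => k _; rewrite mulr0z.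
- by rewrite IH1 IH2 -big_split; apply: eq_bigr => k _; rewrite mulrzDr.
- by rewrite IH -sumrN; apply: eq_bigr => k _; rewrite mulrNz.
- by rewrite IH -sumrMnl; apply: eq_bigr => k _; rewrite mulrzA.
- rewrite IH (big_morph (fun x => x *~ n) (fun x y => mulrzDl n x y) (mul0rz _ n)).
  by apply: eq_bigr => k _; rewrite mulrzA.
Qed.

Lemma zeval_eq (V : zmodType) (env : seq V) e1 e2 :
  all (fun k => zcoef e1 k == zcoef e2 k) (iota 0 (size env)) ->
  zeval env e1 = zeval env e2.
Proof.
move=> /allP h; rewrite !zevalE; apply: eq_bigr => k _; congr (_ *~ _).
by apply/eqP/h; rewrite mem_iota ltn_ord.
Qed.

Ltac zmem x l :=
  lazymatch l with
  | nil => constr:(false)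
  | x :: _ => constr:(true)
  | _ :: ?l' => zmem x l'
  end.
Ltac zatoms t l :=
  lazymatch t with
  | ?a + ?b => let l1 := zatoms a l in zatoms b l1
  | - ?a => zatoms a l
  | ?a *+ _ => zatoms a l
  | ?a *~ _ => zatoms a l
  | 0 => l
  | _ => let m := zmem t l in
         lazymatch m with true => l | false => constr:(t :: l) end
  end.
Ltac zindex x l :=
  lazymatch l with
  | x :: _ => constr:(0%N)
  | _ :: ?l' => let n := zindex x l' in constr:(n.+1)
  end.
Ltac zquote t l :=
  lazymatch t with
  | ?a + ?b => let e1 := zquote a l in let e2 := zquote b l in
               constr:(ZAdd e1 e2)
  | - ?a => let e := zquote a l in constr:(ZOpp e)
  | ?a *+ ?n => let e := zquote a l in constr:(ZMuln e n)
  | ?a *~ ?n => let e := zquote a l in constr:(ZMulz e n)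
  | 0 => constr:(ZZero)
  | _ => let i := zindex t l in constr:(ZVar i)
  end.
Ltac zmod :=
  lazymatch goal with
  | |- @eq ?V ?l ?r =>
    let a0 := zatoms l (@nil V) in let a := zatoms r a0 in
    let e1 := zquote l a in let e2 := zquote r a in
    exact (@zeval_eq _ a e1 e2 isT)
  end.

(* The identity [l = r] follows from the linear combination [n * (x - y)] of the
   relation [x = y]; likewise [zlin2] for two relations. *)
Lemma zlin (V : zmodType) (n : int) (x y l r : V) :
  x = y -> l - r = (x - y) *~ n -> l = r.
Proof. by move=> ->; rewrite subrr mul0rz => /subr0_eq. Qed.

Arguments zlin [V] n [x y l r].

Lemma zlin2 (V : zmodType) (n m : int) (x y x' y' l r : V) :
  x = y -> x' = y' -> l - r = (x - y) *~ n + (x' - y') *~ m -> l = r.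
Proof. by move=> -> ->; rewrite !subrr !mul0rz addr0 => /subr0_eq. Qed.
Arguments zlin2 [V] n m [x y x' y' l r].

(** * Two-fold automorphisms *)

Section TwofoldAutomorphisms.
Variables (T : finType) (e : rel T).
Hypothesis e_sym : symmetric e.

Definition twofold (f g : T -> T) :=
  [/\ injective f, injective g & forall x y, e (f x) (g y) = e x y].

(** Letting [f] act on layer 0 and [g] on layer 1 gives an automorphism of the double cover, and a
    product of a permutation of the vertices with one of the layers acts alike on both layers. *)
Lemma stable_twofold f g : stable e -> twofold f g -> f =1 g.
Proof.
move=> /eqP st [f_inj g_inj fgE].
pose phi (x : T * bool) := (if x.2 then g x.1 else f x.1, x.2).
have phi_inj : injective phi.
  by case=> x [] [y []] // [] => [/g_inj|/f_inj] ->.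
have : perm phi_inj \in graph_aut (double_cover e).
  apply/graph_autP => -[x i] [y j]; rewrite !permE /double_cover /phi /=.
  by case: i j => [] [] //=; rewrite e_sym fgE e_sym.
rewrite st => /imset2P[p s _ _ phiE] x.
have : perm phi_inj (x, false) = pair_perm p s (x, false) by rewrite phiE.
have : perm phi_inj (x, true) = pair_perm p s (x, true) by rewrite phiE.
by rewrite !permE /= => -[-> _] [->].
Qed.

(* [no_potential] holds for connected non-bipartite graphs: a function on the
   vertices of the double cover that is constant along edges is constant. *)
Lemma twofold_stable :
    (forall psi : T * bool -> bool,
       (forall x y i, e x y -> psi (x, i) = psi (y, ~~ i)) ->
       forall u v, psi u = psi v) ->
    (forall f g, twofold f g -> f =1 g) -> stable e.
Proof.
move=> no_potential fg_eq; apply/eqP/setP => phi.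
apply/idP/imset2P => [/graph_autP phi_aut|[p s p_aut _ ->]]; last first.
  exact: pair_perm_aut.
(* Whether [phi] moves a vertex to the other layer is constant along edges, since adjacent vertices
   lie in different layers. *)
have layer i j x y : ((phi (x, i)).2 (+) i) = ((phi (y, j)).2 (+) j).
  apply: (no_potential (fun u => (phi u).2 (+) u.2) _ (x, i) (y, j)).
  move=> {}x {}y {}i /= exy.
  have /andP[+ _] : double_cover e (phi (x, i)) (phi (y, ~~ i)).
    by rewrite phi_aut /double_cover /= exy; case: i.
  by case: (phi (x, i)).2; case: (phi (y, ~~ i)).2; case: i.
have [x0 _|T0] := pickP (@predT T); last first.
  exists 1%g 1%g; rewrite ?in_setT ?group1 //.
  by apply/permP => -[x]; have := T0 x.
pose b := (phi (x0, false)).2.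
have phi2 x i : (phi (x, i)).2 = b (+) i.
  by rewrite -[LHS](addbK i) (layer i false x x0) addbF.
pose f x := (phi (x, false)).1; pose g x := (phi (x, true)).1.
have f_inj : injective f.
  move=> x y fxy; have : phi (x, false) = phi (y, false).
    by rewrite [LHS]surjective_pairing [RHS]surjective_pairing !phi2 -/(f x) fxy.
  by move/perm_inj => [].
have g_inj : injective g.
  move=> x y fxy; have : phi (x, true) = phi (y, true).
    by rewrite [LHS]surjective_pairing [RHS]surjective_pairing !phi2 -/(g x) fxy.
  by move/perm_inj => [].
have fgE : forall x y, e (f x) (g y) = e x y.
  move=> x y; have := phi_aut (x, false) (y, true).
  by rewrite /double_cover /= !phi2; case: (b).
have fg : f =1 g by apply: fg_eq.
have s_inj : injective (addb b) by exact: addbI.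
exists (perm f_inj) (perm s_inj); rewrite ?in_setT //.
  by apply/graph_autP => x y; rewrite !permE (fg y) fgE.
apply/permP => -[x i]; rewrite [LHS]surjective_pairing !permE phi2 /pair_map /= permE.
by case: i; rewrite permE // fg.
Qed.

End TwofoldAutomorphisms.

(** * Invariant sets of differences *)

Section Invariants.
Variables (G : finZmodType) (S : pred G).

(* [twofold] for the Cayley graph with connection set [S]. *)
Definition tf (f g : G -> G) :=
  [/\ injective f, injective g & forall x y, S (g y - f x) = S (y - x)].

Definition tf_trivial := forall f g, tf f g -> f =1 g.

(** Only differences that start in the layer of [f] are mentioned; those starting in the layer of
    [g] follow from the pair [(g, f)], by [tf_sym]. *)
Definition tf_inv (e : bool) (A : pred G) :=
  forall f g, tf f g ->
  forall x y, A ((if e then g y else f y) - f x) = A (y - x).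

Lemma eq_tf_inv e (A B : pred G) : A =1 B -> tf_inv e A -> tf_inv e B.
Proof. by move=> AB iA f g /iA iAfg x y; rewrite -!AB iAfg. Qed.

Lemma tf_inv_S : tf_inv true S.
Proof. by move=> f g []. Qed.

Lemma tf_inv_diff e (A B : pred G) :
  tf_inv e A -> tf_inv e B -> tf_inv e (fun d => A d && ~~ B d).
Proof. by move=> iA iB f g fg x y; rewrite iA ?iB. Qed.

Lemma tf_inv_trivial (A : pred G) : tf_inv true A -> A =1 pred1 0 -> tf_trivial.
Proof.
move=> iA A0 f g fg x; have := iA _ _ fg x x.
by rewrite /= subrr !A0 /= eqxx subr_eq0 => /eqP.
Qed.

Hypothesis S_opp : forall x, S (- x) = S x.

Lemma tf_sym f g : tf f g -> tf g f.
Proof.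
move=> [f_inj g_inj fgE]; split=> // x y.
by rewrite -opprB S_opp fgE -opprB S_opp.
Qed.

(** The coefficient of [d] in the product of the indicator functions of [A] and [B] in the group
    ring. *)
Definition nconv (A B : pred G) (d : G) := #|[pred s | A s && B (d - s)]|.

(** Representations of [y - x] correspond to middle points [z] with [z - x] in [A] and [y - z] in
    [B]; the permutation acting on the layer of [z] preserves both conditions. *)
Lemma tf_inv_conv e1 e2 (A B : pred G) k :
  tf_inv e1 A -> tf_inv e2 B -> tf_inv (e1 (+) e2) (fun d => nconv A B d == k).
Proof.
move=> iA iB f g fg x y; congr (_ == k).
have shift (u v : G) : nconv A B (v - u) =
    #|[pred z | A (z - u) && B (v - z)]|.
  rewrite /nconv -(card_image (addIr u)); apply: eq_card => z /=.
  rewrite !inE; apply/imageP/idP => [[s] + ->|zAB].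
    by rewrite !inE addrK opprD addrA addrAC.
  exists (z - u); rewrite ?subrK // !inE.
  by rewrite opprB addrA addrNK.
have [f_inj g_inj _] := fg; pose h := if e1 then g else f.
have h_inj : injective h by rewrite /h; case: (e1).
rewrite !shift -[RHS](card_image h_inj); apply: eq_card => z.
have [h' hK h'K] : bijective h := injF_bij h_inj.
rewrite -(h'K z) (mem_image h_inj) !inE; move: (h' z) => {}z.
have -> : A (h z - f x) = A (z - x).
  by have := iA _ _ fg x z; rewrite /h; case: (e1).
congr (_ && _); have := iB _ _ fg z y; have := iB _ _ (tf_sym fg) z y.
by rewrite /h; case: (e1); case: (e2).
Qed.

End Invariants.

(** * Computing invariant sets *)

Section SchurChains.
Variables (G : finZmodType) (S : pred G).
Hypothesis S_opp : forall x, S (- x) = S x.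
Variables (u v : G).

Local Notation vec := (int * int)%type.
Implicit Types (p q : vec) (L : seq vec).

(** Sets are represented by lists of coordinate vectors, so that one computation serves all groups
    satisfying the same relations. *)
Definition mu p : G := u *~ p.1 + v *~ p.2.

Definition vadd p q : vec := (p.1 + q.1, p.2 + q.2).
Definition vsub p q : vec := (p.1 - q.1, p.2 - q.2).

Lemma muD p q : mu (vadd p q) = mu p + mu q.
Proof. by rewrite /mu /= !mulrzDr addrACA. Qed.

Lemma muB p q : mu (vsub p q) = mu p - mu q.
Proof. by rewrite /mu /= !mulrzBr opprD addrACA. Qed.

(* [rel p] decides [mu p = 0] for the vectors [p] of the window [win]. *)
Variables (win rel : pred vec).
Hypothesis relP : forall p, win p -> (mu p == 0) = rel p.

Definition veq p q := rel (vsub p q).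
Definition vwin p q := win (vsub p q).

Lemma veqP p q : vwin p q -> (mu p == mu q) = veq p q.
Proof. by move=> /relP; rewrite muB subr_eq0. Qed.

Fixpoint vuniq L :=
  if L is p :: L' then all (fun q => vwin p q && ~~ veq p q) L' && vuniq L'
  else true.

Lemma vuniqP L : vuniq L -> uniq (map mu L).
Proof.
elim: L => //= p L IH /andP[/allP pL /IH ->]; rewrite andbT.
apply/mapP => -[q /pL/andP[pq_win pq_neq]] /eqP.
by rewrite veqP // (negbTE pq_neq).
Qed.

(** Vectors whose difference is outside the window are kept, so equal elements may survive; only the
    set of elements is guaranteed. *)
Fixpoint vundup L :=
  if L is p :: L' then
    let L'' := vundup L' in
    if has (fun q => vwin p q && veq p q) L'' then L'' else p :: L''
  else [::].

Lemma vundupP L : map mu (vundup L) =i map mu L.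
Proof.
elim: L => //= p L IH x; case: hasP => [[q qL /andP[w r]]|_]; last first.
  by rewrite !inE IH.
rewrite !inE IH; have [->|//] := eqVneq x (mu p).
by move: r; rewrite -veqP // -IH => /eqP->; rewrite map_f.
Qed.

Definition vcount L1 L2 p :=
  count (fun s => has (fun t => veq (vsub p s) t) L2) L1.

Definition vsums L1 L2 := vundup [seq vadd s t | s <- L1, t <- L2].

Definition vconv k L1 L2 := [seq p <- vsums L1 L2 | vcount L1 L2 p == k].

(** For [k = 0] the elements outside the sumset would qualify too, repetitions in [L1] would be
    counted twice, and the comparisons made by [vcount] must fall in the window. *)
Definition vconv_ok k L1 L2 :=
  [&& (0 < k)%N, vuniq L1 & all (fun p => all (fun s =>
     all (fun t => vwin (vsub p s) t) L2) L1) (vsums L1 L2)].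

Definition vdiff L1 L2 := [seq p <- L1 | ~~ has (veq p) L2].

Definition vdiff_ok L1 L2 := all (fun p => all (vwin p) L2) L1.

Definition den L : pred G := fun x => x \in map mu L.

Lemma veq_has p L : all (vwin p) L -> has (veq p) L = (mu p \in map mu L).
Proof.
elim: L => //= q L IH /andP[w /IH ->].
by rewrite inE veqP.
Qed.

Lemma vconvP k L1 L2 : vconv_ok k L1 L2 ->
  (fun d => nconv (den L1) (den L2) d == k) =1 den (vconv k L1 L2).
Proof.
case/and3P => k_gt0 /vuniqP L1_uniq /allP winL d.
have nconvE : nconv (den L1) (den L2) d =
    count (fun s => d - mu s \in map mu L2) L1.
  rewrite -(count_map mu (fun x => d - x \in map mu L2)) -size_filter.
  rewrite -(card_uniqP _) ?filter_uniq //; apply: eq_card => x.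
  by rewrite mem_filter andbC.
have cntE p : p \in vsums L1 L2 -> mu p = d ->
    vcount L1 L2 p = nconv (den L1) (den L2) d.
  move=> /winL/allP w pd; rewrite nconvE -pd; apply: eq_in_count => s sL1.
  by rewrite veq_has ?muB //; exact: w.
apply/eqP/mapP => [dk|[p + dp]]; last first.
  by rewrite mem_filter => /andP[/eqP<- /cntE ->].
have /card_gt0P[x] : (0 < nconv (den L1) (den L2) d)%N by rewrite dk.
rewrite !inE => /andP[/mapP[s sL1 ->] /mapP[t tL2 dE]].
have : d \in map mu (vsums L1 L2).
  by rewrite vundupP -(subrK (mu s) d) dE addrC -muD map_f // allpairs_f.
case/mapP => p pL dp; exists p => //.
by rewrite mem_filter pL cntE ?dk ?eqxx.
Qed.

Lemma vdiffP L1 L2 : vdiff_ok L1 L2 ->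
  (fun d => den L1 d && ~~ den L2 d) =1 den (vdiff L1 L2).
Proof.
move=> /allP winL d; apply/andP/mapP => [[/mapP[p pL1 ->] pL2]|[p + ->]].
  by exists p; rewrite // mem_filter pL1 veq_has ?winL // pL2.
rewrite mem_filter => /andP[+ pL1]; rewrite veq_has ?winL //.
by split; rewrite // /den map_f.
Qed.

(* [Conv i j k] produces the elements with exactly [k] representations as a sum of
   elements of the nodes [i] and [j] of the list built so far, [Diff i j] the
   difference of these nodes.  An ill-formed step yields the empty set. *)
Inductive step := Conv of nat & nat & nat | Diff of nat & nat.

Definition node := (bool * seq vec)%type.
Definition node_inv (nd : node) := tf_inv S nd.1 (den nd.2).

Definition do_step (ns : seq node) (st : step) : node :=
  let nd i := nth (false, [::]) ns i in
  match st with
  | Conv i j k =>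
    if vconv_ok k (nd i).2 (nd j).2
    then ((nd i).1 (+) (nd j).1, vconv k (nd i).2 (nd j).2)
    else (false, [::])
  | Diff i j =>
    if ((nd i).1 == (nd j).1) && vdiff_ok (nd i).2 (nd j).2
    then ((nd i).1, vdiff (nd i).2 (nd j).2)
    else (false, [::])
  end.

(** Node 0 is the connection set, between opposite layers; node [i] is the result of the [i]-th
    step. *)
Definition run L sts :=
  foldl (fun ns st => rcons ns (do_step ns st)) [:: (true, L)] sts.

Lemma node_inv0 : node_inv (false, [::]).
Proof. by move=> f g _ x y; rewrite /den !in_nil. Qed.

Lemma run_inv L sts i : S =1 den L -> node_inv (nth (false, [::]) (run L sts) i).
Proof.
move=> SL; have: forall j, node_inv (nth (false, [::]) [:: (true, L)] j).
  by case=> [|j]; [exact: eq_tf_inv SL (@tf_inv_S _ S)|rewrite /= nth_nil; exact: node_inv0].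
rewrite /run; elim: sts i [:: _] => //= st sts IH i ns ns_inv.
apply: IH => j; rewrite nth_rcons; case: ifP => // _; case: ifP => // _.
  case: st => [i1 i2 k|i1 i2] /=; case: ifP => [ok|_]; try exact: node_inv0.
    apply: eq_tf_inv (vconvP ok) _.
    exact: tf_inv_conv (ns_inv i1) (ns_inv i2).
  case/andP: ok => /eqP e12 ok; apply: eq_tf_inv (vdiffP ok) _.
  by apply: tf_inv_diff (ns_inv i1) _; rewrite e12; exact: ns_inv.
Qed.

Definition run_zero L sts :=
  let nd := last (false, [::]) (run L sts) in
  [&& nd.1, nd.2 != [::] & all (fun p => win p && rel p) nd.2].

(** The last node is {0} between opposite layers, and its invariance says that [g x - f x = 0]. *)
Lemma run_zero_trivial L sts : S =1 den L -> run_zero L sts -> tf_trivial S.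
Proof.
move=> SL; rewrite /run_zero -nth_last; set i := (size _).-1.
have := run_inv sts i SL; case: (nth _ _ i) => e L' /= iL' /and3P[e1 L'0 /allP L'P].
apply: (@tf_inv_trivial _ _ (den L')); first by rewrite e1 in iL'.
have mu0 p : p \in L' -> mu p = 0.
  by move=> /L'P/andP[w r]; apply/eqP; rewrite relP.
move=> x; apply/mapP/eqP => [[p /mu0 p0 ->] //|->].
by case: L' L'0 mu0 {iL' L'P} => // p L' _ mu0; exists p; rewrite ?mu0 ?mem_head.
Qed.

End SchurChains.

(** * Orders modulo a cyclic subgroup *)

Section Orders.
Variable G : finZmodType.
Implicit Types (x y u v : G).

Lemma dvdn_orderE x n : (#[x]%g %| n)%N = (x *+ n == 0).
Proof. by rewrite order_dvdn FinRing.zmodXgE. Qed.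

Lemma dvdz_orderE x (i : int) : (#[x]%g %| `|i|)%N = (x *~ i == 0).
Proof.
rewrite dvdn_orderE; case: i => n; rewrite ?NegzE ?abszN /= ?mulrNz ?oppr_eq0 //.
Qed.

(** If [n] is [k] times the order with [k > 1], then a prime [p] dividing [k] already gives
    [x *+ (n %/ p) = 0]. *)
Lemma order_eq x n : x *+ n = 0 ->
  all (fun p => x *+ (n %/ p) != 0) (primes n) -> (0 < n)%N -> #[x]%g = n.
Proof.
move=> /eqP; rewrite -dvdn_orderE => /dvdnP[k nE] /allP x_neq0 n_gt0.
have [k1|k_neq1] := eqVneq k 1%N; first by rewrite nE k1 mul1n.
have k_gt0 : (0 < k)%N by case: k nE n_gt0 {k_neq1} => // ->.
have k_gt1 : (1 < k)%N by rewrite ltn_neqAle eq_sym k_neq1.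
have := x_neq0 (pdiv k); rewrite -dvdn_orderE mem_primes n_gt0 pdiv_prime //=.
rewrite nE dvdn_mulr ?pdiv_dvd // -divn_mulAC ?pdiv_dvd // dvdn_mull //.
by move/(_ isT).
Qed.

Lemma cycleE v x : x \in <[v]>%g -> exists2 j, (j < #[v]%g)%N & x = v *+ j.
Proof. by case/cyclePmin => j lt_j ->; exists j; rewrite ?FinRing.zmodXgE. Qed.

Definition ord_mod v u := #[coset <[v]>%g u]%g.

Lemma cycle_norm v x : x \in 'N(<[v]>)%g.
Proof.
exact/(subsetP (sub_abelian_norm (FinRing.zmod_abelian setT) (subsetT _)))/in_setT.
Qed.

Lemma ord_modE v u n : (ord_mod v u %| n)%N = (u *+ n \in <[v]>%g).
Proof.
rewrite /ord_mod order_dvdn -morphX ?cycle_norm // -FinRing.zmodXgE.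
apply/eqP/idP => [|h]; last exact: coset_id.
by apply: coset_idr; rewrite cycle_norm.
Qed.

Lemma index_mod v u : u *+ #|[set: G] : <[v]>|%g \in <[v]>%g.
Proof.
rewrite -ord_modE /ord_mod -card_quotient; last first.
  by apply/subsetP => x _; exact: cycle_norm.
by apply: order_dvdG; rewrite mem_quotient ?in_setT.
Qed.

Lemma card_index v : (#|G| = #[v]%g * #|[set: G] : <[v]>|%g)%N.
Proof. by rewrite -cardsT -(Lagrange (subsetT <[v]>%g)). Qed.

Lemma ord_mod_dvd v u : (#[v]%g * ord_mod v u %| #|G|)%N.
Proof. by rewrite (card_index v) dvdn_mul // ord_modE index_mod. Qed.

Definition gen2 u v := forall x, exists i j : int, x = u *~ i + v *~ j.

(** The coefficient of [u] is reduced modulo its order modulo [v]; the part removed lies in the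
    subgroup generated by [v]. *)
Lemma gen2_elt u v x : gen2 u v ->
  exists i j, [/\ (i < ord_mod v u)%N, (j < #[v]%g)%N & x = u *+ i + v *+ j].
Proof.
move=> /(_ x)[i [j ->]]; set o := ord_mod v u.
have o_neq0 : o%:Z != 0 by rewrite eqz_nat -lt0n order_gt0.
have ouv : u *+ o \in <[v]>%g by rewrite -ord_modE.
have r_ge0 := modz_ge0 i o_neq0.
exists `|modz i o|%N.
have : u *~ (divz i o * o) + v *~ j \in <[v]>%g.
  have : u *+ o *~ (divz i o) + v *~ j \in <[v]>%g.
    apply: groupM.
      case: (divz i o) => k; rewrite ?NegzE ?mulrNz; last apply: groupVr;
      by rewrite -pmulrn -FinRing.zmodXgE groupX.
    case: j => k; rewrite ?NegzE ?mulrNz; last apply: groupVr;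
    by rewrite -pmulrn -FinRing.zmodXgE groupX ?cycle_id.
  by rewrite mulrC mulrzA.
case/cycleE => k lt_k kE; exists k; split=> //.
  by rewrite -ltz_nat gez0_abs // ltz_mod.
rewrite -kE pmulrn gez0_abs //.
by rewrite addrA -mulrzDr [(_ %% _)%Z + _]addrC -divz_eq.
Qed.

End Orders.

(** * Deciding linear relations between two elements *)

Section Oracles.
Variables (G : finZmodType) (u v : G).
Implicit Types (p : int * int).

Lemma ord_modzE i : (ord_mod v u %| `|i|)%N = (u *~ i \in <[v]>%g).
Proof.
rewrite ord_modE; case: i => n; first by rewrite -pmulrn.
by rewrite NegzE abszN /= mulrNz -pmulrn -FinRing.zmodVgE groupV.
Qed.

Lemma mem_cyclez j : v *~ j \in <[v]>%g.
Proof.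
case: j => k; rewrite ?NegzE ?mulrNz -?FinRing.zmodVgE ?groupV;
by rewrite -pmulrn -FinRing.zmodXgE mem_cycle.
Qed.

Lemma mu_eq0_dvd p : mu u v p = 0 -> (ord_mod v u %| `|p.1|)%N.
Proof.
move=> /addr0_eq vE; rewrite ord_modzE -groupV FinRing.zmodVgE vE.
exact: mem_cyclez.
Qed.

Definition win_le (B : nat) p := (`|p.1| <= B)%N.
Definition win_all p := true.

(** [rel_grid] is vanishing in Z/o x Z/r, for orders known exactly; [rel_strip] is vanishing in Z x
    Z/r, which agrees with the group as long as the first coordinate is below the order of [u]
    modulo [v]. *)
Definition rel_grid (o r : nat) p := (o %| `|p.1|)%N && (r %| `|p.2|)%N.
Definition rel_strip (r : nat) p := (p.1 == 0) && (r %| `|p.2|)%N.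

Lemma rel_stripP B r : (B < ord_mod v u)%N -> #[v]%g = r ->
  forall p, win_le B p -> (mu u v p == 0) = rel_strip r p.
Proof.
move=> lt_B <- p pB; rewrite /rel_strip dvdz_orderE.
apply/eqP/andP => [mu0|[/eqP p0 /eqP vp]]; last first.
  by rewrite /mu p0 mulr0z add0r.
have /dvdn_leq := mu_eq0_dvd mu0; rewrite absz_gt0 => p1.
have p0 : p.1 = 0.
  by apply/eqP; apply: contraTT lt_B => /p1 le_o; rewrite -leqNgt (leq_trans le_o).
by move: mu0; rewrite /mu p0 mulr0z add0r => ->; rewrite !eqxx.
Qed.

Lemma rel_gridP o r : ord_mod v u = o -> u *+ o = 0 -> #[v]%g = r ->
  forall p, win_all p -> (mu u v p == 0) = rel_grid o r p.
Proof.
move=> <- uo <- p _; rewrite /rel_grid dvdz_orderE.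
have uo0 : (ord_mod v u %| `|p.1|)%N -> u *~ p.1 = 0.
  move=> h; apply/eqP; rewrite -dvdz_orderE; apply: dvdn_trans h.
  by rewrite dvdn_orderE uo.
apply/eqP/andP => [mu0|[/uo0 p0 /eqP vp]]; last by rewrite /mu p0 vp addr0.
have o_dvd := mu_eq0_dvd mu0; split=> //.
by move: mu0; rewrite /mu uo0 // add0r => ->.
Qed.

(** Cyclic groups are encoded with [v = 0], whose order is 1. *)
Lemma rel_gridP1 n : v = 0 -> #[u]%g = n ->
  forall p, win_all p -> (mu u v p == 0) = rel_grid n 1 p.
Proof.
by move=> -> <- p _; rewrite /mu mul0rz addr0 -dvdz_orderE /rel_grid dvd1n andbT.
Qed.

Lemma rel_stripP1 B : v = 0 -> (B < #[u]%g)%N ->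
  forall p, win_le B p -> (mu u v p == 0) = rel_strip 1 p.
Proof.
move=> -> lt_B p pB; rewrite /mu mul0rz addr0 -dvdz_orderE /rel_strip dvd1n andbT.
have [->|p0] := eqVneq p.1 0; first by rewrite dvdn0.
by rewrite gtnNdvd ?absz_gt0 // (leq_ltn_trans pB).
Qed.

End Oracles.

(** * Triples of generators *)

Section Triples.
Variable G : finZmodType.
Implicit Types (a b c x y z : G).

Definition conn a b c : pred G := fun x => x \in [:: a; - a; b; - b; c; - c].

Definition triple a b c :=
  [/\ gen2 a b, a + b + c = 0 &
      [&& a != b, a != - b, b != c, b != - c, a != c & a != - c]].

Definition exceptional a b c := exists x y z : G,
  perm_eq [:: x; y; z] [:: a; b; c] /\
    (   (#[x]%g = 4)%N /\ (8 %| #|G|)%N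
     \/ x *+ 2 = y *+ 2 /\ (8 %| #|G|)%N
     \/ (#[x]%g = 8)%N /\ y = x *+ 3
     \/ (#[x]%g = 12)%N /\ y = x *+ 4
     \/ (#[x]%g = 3)%N /\ (#[y]%g = 3)%N).

Definition decided a b c := tf_trivial (conn a b c) \/ exceptional a b c.

Lemma conn_opp a b c x : conn a b c (- x) = conn a b c x.
Proof.
rewrite /conn !inE !eqr_opp !(eqr_oppLR x).
by move: (x == a) (x == - a) (x == b) (x == - b) (x == c) (x == - c)
  => [] [] [] [] [] [].
Qed.

Lemma conn_rot a b c : conn b c a =1 conn a b c.
Proof.
move=> x; rewrite /conn !inE.
by move: (x == a) (x == - a) (x == b) (x == - b) (x == c) (x == - c)
  => [] [] [] [] [] [].
Qed.

Lemma conn_swap a b c : conn b a c =1 conn a b c.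
Proof.
move=> x; rewrite /conn !inE.
by move: (x == a) (x == - a) (x == b) (x == - b) (x == c) (x == - c)
  => [] [] [] [] [] [].
Qed.

Lemma eqN_sym x y : (x == - y) = (y == - x).
Proof. by rewrite -eqr_oppLR eq_sym. Qed.

Lemma triple_rot a b c : triple a b c -> triple b c a.
Proof.
case=> gen abc /and5P[ab aNb bc bNc /andP[ac aNc]]; split.
- move=> x; have [i [j ->]] := gen x; exists (j - i), (- i).
  have -> : c = - (a + b) by apply: (zlin 1 abc); zmod.
  rewrite mulNrz mulrNz opprK mulrzBr mulrzDl [RHS]addrC -addrA; congr (_ + _).
  by rewrite addrCA subrr addr0.
- by rewrite addrC addrA.
- rewrite bc bNc [c == a]eq_sym ac eqN_sym aNc [b == a]eq_sym ab.
  by rewrite eqN_sym aNb.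
Qed.

Lemma triple_swap a b c : triple a b c -> triple b a c.
Proof.
case=> gen abc /and5P[ab aNb bc bNc /andP[ac aNc]]; split.
- by move=> x; have [i [j ->]] := gen x; exists j, i; rewrite addrC.
- by rewrite [b + a]addrC.
- by rewrite [b == a]eq_sym ab eqN_sym aNb ac aNc bc bNc.
Qed.

(** A rotation and a transposition generate the symmetric group on three letters. *)
Lemma perm3_ind (P : G -> G -> G -> Prop) :
  (forall x y z, P x y z -> P y z x) -> (forall x y z, P x y z -> P y x z) ->
  forall a b c x y z, perm_eq [:: x; y; z] [:: a; b; c] -> P a b c -> P x y z.
Proof.
move=> rot swap a b c x y z + Pabc.
have permK (t : seq G) w s : perm_eq (w :: s) t -> w \in t /\ perm_eq s (rem w t).
  move=> ws; have wt : w \in t by rewrite -(perm_mem ws) mem_head.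
  by split=> //; rewrite -(perm_cons w) (perm_trans ws) // perm_to_rem.
case/permK; rewrite !inE /= => xabc.
have step2 b' c' : perm_eq [:: y; z] [:: b'; c'] ->
    (y = b' /\ z = c') \/ (y = c' /\ z = b').
  case/permK; rewrite !inE /=; case: (eqVneq b' y) => [->|_] /=.
    by move=> _ /permK[]; rewrite inE => /eqP; left.
  case: (eqVneq y c') => [->|//] _.
  by case/permK; rewrite inE => /eqP; right.
case: (eqVneq a x) xabc => [<- _|_ /=].
  by case/step2 => -[-> ->] //; exact: swap (rot _ _ _ (rot _ _ _ Pabc)).
rewrite ![x == _]eq_sym; case: (eqVneq b x) => [<- _|_ /=].
  by case/step2 => -[-> ->]; [exact: swap|exact: rot].
case: (eqVneq c x) => [<- _|//].
case/step2 => -[-> ->]; last by apply: swap; exact: rot.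
exact: rot _ _ _ (rot _ _ _ Pabc).
Qed.

Lemma triple_perm a b c x y z :
  perm_eq [:: x; y; z] [:: a; b; c] -> triple a b c -> triple x y z.
Proof. exact: perm3_ind triple_rot triple_swap _ _ _ _ _ _. Qed.

Lemma conn_perm a b c x y z :
  perm_eq [:: x; y; z] [:: a; b; c] -> conn x y z =1 conn a b c.
Proof.
move=> pe; apply: (perm3_ind _ _ pe (P := fun x y z => conn x y z =1 conn a b c)) => //.
  by move=> u v w h t; rewrite conn_rot h.
by move=> u v w h t; rewrite conn_swap h.
Qed.

End Triples.

(** * The non-generic triples *)

Section DegenerateTriples.
Variable G : finZmodType.
Implicit Types (a b c x y z : G).

Lemma exceptional_perm a b c x y z :
  perm_eq [:: x; y; z] [:: a; b; c] -> exceptional x y z -> exceptional a b c.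
Proof.
move=> pe [x1 [y1 [z1 [pe1 h]]]].
by exists x1, y1, z1; split; first exact: perm_trans pe1 pe.
Qed.

Lemma eq_tf_trivial (S1 S2 : pred G) :
  S1 =1 S2 -> tf_trivial S1 -> tf_trivial S2.
Proof.
move=> eqS tr f g [f_inj g_inj fg]; apply: tr; split=> // x y.
by rewrite !eqS.
Qed.

Lemma decided_perm a b c x y z :
  perm_eq [:: x; y; z] [:: a; b; c] -> decided x y z -> decided a b c.
Proof.
move=> pe [tr|ex]; last by right; exact: exceptional_perm pe ex.
by left; apply: eq_tf_trivial tr; exact: conn_perm.
Qed.

Lemma perm3_bca a b c : perm_eq [:: b; c; a] [:: a; b; c].
Proof. exact: (permEl (perm_rot 1 [:: a; b; c])). Qed.

Lemma perm3_cab a b c : perm_eq [:: c; a; b] [:: a; b; c].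
Proof. exact: (permEl (perm_rot 2 [:: a; b; c])). Qed.

Lemma perm3_bac a b c : perm_eq [:: b; a; c] [:: a; b; c].
Proof. exact: (permEl (perm_catCA [:: b] [:: a] [:: c])). Qed.

Lemma perm3_acb a b c : perm_eq [:: a; c; b] [:: a; b; c].
Proof. by rewrite perm_cons (perm_catC [:: c] [:: b]). Qed.

Lemma perm3_cba a b c : perm_eq [:: c; b; a] [:: a; b; c].
Proof. exact: perm_trans (perm3_bac _ _ _) (perm3_bca _ _ _). Qed.

Lemma triple_neq0 a b c : triple a b c -> [/\ a != 0, b != 0 & c != 0].
Proof.
have neq0 x y z : triple x y z -> x != 0.
  move=> [_ xyz /and5P[_ _ _ yNz _]]; apply: contraNneq yNz => x0.
  by apply/eqP; apply: (zlin 1 xyz); rewrite x0; zmod.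
by move=> t; split; [apply: neq0 t|apply: neq0 (triple_rot t)
                    |apply: neq0 (triple_rot (triple_rot t))].
Qed.

Lemma conn0 a b c : triple a b c -> conn a b c 0 = false.
Proof.
case/triple_neq0 => a0 b0 c0.
by rewrite /conn !inE ![0 == _]eq_sym !oppr_eq0 (negbTE a0) (negbTE b0) (negbTE c0).
Qed.

(** Since 0 is not in the connection set, neither is [g x - f x]; in a complete graph this leaves
    only 0. *)
Lemma complete_trivial a b c : triple a b c ->
  (forall x, x != 0 -> conn a b c x) -> tf_trivial (conn a b c).
Proof.
move=> abc3 full f g [_ _ fg] x; have := fg x x.
rewrite subrr (conn0 abc3) => /negbT; apply: contraNeq => fgx.
by apply: full; rewrite subr_eq0 eq_sym.
Qed.

Lemma order_2 x : x != 0 -> x *+ 2 = 0 -> #[x]%g = 2%N.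
Proof. by move=> x0 x2; apply: order_eq; rewrite //= x0. Qed.

Lemma order_3 x : x != 0 -> x *+ 3 = 0 -> #[x]%g = 3%N.
Proof. by move=> x0 x3; apply: order_eq; rewrite //= x0. Qed.

Lemma ord_mod_gt0 (u v : G) : (0 < ord_mod v u)%N.
Proof. exact: order_gt0. Qed.

Lemma ord_modP (u v : G) :
  exists2 j, (j < #[v]%g)%N & u *+ ord_mod v u = v *+ j.
Proof. by have := dvdnn (ord_mod v u); rewrite ord_modE => /cycleE. Qed.

Lemma ord_mod_neq0 (u v : G) n : ~~ (ord_mod v u %| n)%N -> u *+ n != 0.
Proof. by rewrite ord_modE; apply: contraNneq => ->; exact: group1. Qed.

(** The cases follow the order of [b] modulo the involution [a]: 1 is contradictory, 2 and 3 give
    complete graphs, 4 makes 8 divide the order of the group and leads to an exceptional triple, and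
    one chain settles all larger orders. *)
Lemma decided_2x a b c : triple a b c -> a *+ 2 = 0 -> decided a b c.
Proof.
move=> abc3 a2; have [gen abc /and5P[ab aNb bc bNc /andP[ac aNc]]] := abc3.
have Na : - a = a by apply: (zlin (-1) a2); zmod.
have a0 : a != 0.
  by apply: contraNneq bNc => a0; apply/eqP; apply: (zlin 1 abc); rewrite a0; zmod.
have oa := order_2 a0 a2.
have cE : c = - b - a by apply: (zlin 1 abc); zmod.
have cE' : c = - b + a by rewrite cE Na.
have NcE : - c = b + a by rewrite cE; zmod.
have connE x : conn a b c x = (x \in [:: a; b; - b; - b + a; b + a]).
  by rewrite /conn !inE Na NcE cE' orbA orbb.
have gen' : gen2 b a by move=> x; have [i [j ->]] := gen x; exists j, i; rewrite addrC.
have [j lt_j bo] := ord_modP b a; rewrite oa in lt_j.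
have bo' : b *+ ord_mod a b = 0 \/ b *+ ord_mod a b = a.
  by case: j lt_j bo => [|[|//]] _ ->; [left|right].
have [o_big|o_small] := ltnP 4 (ord_mod a b).
  (* With S the connection set, node 1 is {a}, node 2 is S + a and node 3 is S + a minus S, that is
     {0}. *)
  left; apply: (run_zero_trivial (u := b) (v := a) (conn_opp a b c)
    (rel_stripP o_big oa)
    (L := [:: (0, 1); (1, 0); (-1, 0); (-1, 1); (1, 1)])
    (sts := [:: Conv 0 0 4; Conv 0 1 1; Diff 2 0])); last by vm_compute.
  move=> x; rewrite connE /den; congr (_ \in _); rewrite /= /mu /=.
  by do 5?[congr (_ :: _)]; zmod.
have := ord_mod_gt0 b a; case oE: (ord_mod a b) o_small bo' => [|[|[|[|[|//]]]]] // _ bo' _.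
- case: bo' => bE.
    by case/negP: ac; rewrite cE'; apply/eqP; apply: (zlin 1 bE); zmod.
  by case/negP: ab; apply/eqP; apply: (zlin (-1) bE); zmod.
- left; apply: (complete_trivial abc3) => x; rewrite connE.
  have [i [k]] := gen2_elt x gen'; rewrite oE oa => -[].
  case: bo' => bE; last first.
    by case/negP: bc; rewrite cE'; apply/eqP; apply: (zlin 1 bE); zmod.
  case: i => [|[|//]] _; case: k => [|[|//]] _ ->; rewrite ?addr0 ?add0r ?mulr1n;
  by rewrite ?eqxx // !inE eqxx ?orbT.
- left; apply: (complete_trivial abc3) => x; rewrite connE.
  have [i [k]] := gen2_elt x gen'; rewrite oE oa => -[].
  have bE' : b *+ 2 = - b \/ b *+ 2 = - b + a.
    by case: bo' => bE; [left|right]; apply: (zlin 1 bE); zmod.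
  case: i => [|[|[|//]]] _; case: k => [|[|//]] _ ->;
  rewrite ?addr0 ?add0r ?mulr1n ?eqxx // => _; rewrite !inE ?eqxx ?orbT //.
    by case: bE' => ->; rewrite eqxx ?orbT.
  case: bE' => ->; first by rewrite eqxx ?orbT.
  by rewrite -addrA -mulr2n a2 addr0 eqxx ?orbT.
- right; have d8 : (8 %| #|G|)%N by have := ord_mod_dvd a b; rewrite oE oa.
  exists b, c, a; split; first exact: perm3_bca.
  have b2 : b *+ 2 != 0 by apply: (@ord_mod_neq0 b a); rewrite oE.
  case: bo' => bE; [left|right; right; left].
    by split=> //; apply: order_eq => //=; rewrite b2.
  split; last by rewrite cE'; apply: (zlin (-1) bE); zmod.
  apply: order_eq => //=; last by rewrite bE a0.
  by rewrite -a2; apply: (zlin 2 bE); zmod.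
Qed.
Lemma cyc_trivial n x L sts a b c : #[x]%g = n -> conn a b c =1 den x 0 L ->
  run_zero win_all (rel_grid n 1) L sts -> tf_trivial (conn a b c).
Proof.
move=> ox; exact: (run_zero_trivial (conn_opp a b c)
  (rel_gridP1 (erefl (0 : G)) ox)).
Qed.

(* With [w = b - a] the connection set is [{a, -a} + {0, w, -w}]. *)
Lemma decided_3x a b c : triple a b c -> a *+ 3 = 0 -> decided a b c.
Proof.
move=> abc3 a3; have [gen abc /and5P[ab aNb bc bNc /andP[ac aNc]]] := abc3.
have [a0 b0 c0] := triple_neq0 abc3.
have [b2|b2] := eqVneq (b *+ 2) 0.
  apply: decided_perm (perm3_bac a b c) _.
  exact: decided_2x (triple_swap abc3) b2.
have [c2|c2] := eqVneq (c *+ 2) 0.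
  apply: decided_perm (perm3_cab a b c) _.
  exact: decided_2x (triple_rot (triple_rot abc3)) c2.
have oa := order_3 a0 a3.
have [w bE] : exists w, b = w + a by exists (b - a); rewrite subrK.
have cE : c = - w + a by rewrite bE in abc; apply: (zlin2 1 (-1) abc a3); zmod.
have gen' : gen2 w a.
  move=> x; have [i [j ->]] := gen x; exists j, (i + j).
  by rewrite bE mulrzDl mulrzDr addrCA.
have [j lt_j wo] := ord_modP w a; rewrite oa in lt_j.
have wo' : [\/ w *+ ord_mod a w = 0, w *+ ord_mod a w = a | w *+ ord_mod a w = - a].
  case: j lt_j wo => [|[|[|//]]] _ ->; [exact: Or31|exact: Or32|apply: Or33].
  by apply: (zlin 1 a3); zmod.
have [o_big|o_small] := ltnP 4 (ord_mod a w).
  (* Node 1 is {w, -w}, node 2 is {a, -a} between opposite layers, node 3 is the same set within a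
     layer, and node 4 is {0}. *)
  left; apply: (run_zero_trivial (u := w) (v := a) (conn_opp a b c)
    (rel_stripP o_big oa)
    (L := [:: (0, 1); (0, -1); (1, 1); (-1, -1); (-1, 1); (1, -1)])
    (sts := [:: Conv 0 0 4; Conv 0 1 2; Conv 2 2 1; Conv 2 3 2])); last by vm_compute.
  move=> x; rewrite /conn /den bE cE; congr (_ \in _); rewrite /= /mu /=.
  by do 6?[congr (_ :: _)]; zmod.
have := ord_mod_gt0 w a; case oE: (ord_mod a w) o_small wo' => [|[|[|[|[|//]]]]] // _ wo' _.
- case: wo' => wE.
  + by case/negP: ab; rewrite bE; apply/eqP; apply: (zlin (-1) wE); zmod.
  + by case/negP: aNb; rewrite bE; apply/eqP; apply: (zlin2 1 1 wE a3); zmod.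
  + by case/negP: b0; rewrite bE; apply/eqP; apply: (zlin 1 wE); zmod.
- case: wo' => wE.
  + by case/negP: bc; rewrite bE cE; apply/eqP; apply: (zlin 1 wE); zmod.
  + by case/negP: b2; rewrite bE; apply/eqP; apply: (zlin2 1 1 wE a3); zmod.
  + by case/negP: c2; rewrite cE; apply/eqP; apply: (zlin2 (-1) 1 wE a3); zmod.
(* Here [3 w = 0] makes [b] of order 3; otherwise [a] is a multiple of [w] and the group is cyclic
   of order 9. *)
- case: wo' => wE.
  + right; exists b, a, c; split; first exact: perm3_bac.
    do 4!right; split=> //; apply: order_3 => //.
    by rewrite bE; apply: (zlin2 1 1 wE a3); zmod.
  + left; apply: (cyc_trivial (n := 9) (x := w)
      (L := [:: (3, 0); (-3, 0); (4, 0); (-4, 0); (2, 0); (-2, 0)])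
      (sts := [:: Conv 0 0 3; Conv 0 0 5; Conv 1 2 1; Conv 0 3 4])).
    * apply: order_eq => //=; last by rewrite wE a0.
      by apply: (zlin2 3 1 wE a3); zmod.
    * move=> x; rewrite /conn /den bE cE -wE; congr (_ \in _); rewrite /= /mu /=.
      by do 6?[congr (_ :: _)]; zmod.
    * by vm_compute.
  + left; apply: (cyc_trivial (n := 9) (x := w)
      (L := [:: (-3, 0); (3, 0); (-2, 0); (2, 0); (-4, 0); (4, 0)])
      (sts := [:: Conv 0 0 3; Conv 0 0 5; Conv 1 2 1; Conv 0 3 4])).
    * apply: order_eq => //=; last by rewrite wE oppr_eq0 a0.
      by apply: (zlin2 3 (-1) wE a3); zmod.
    * have aE : a = - (w *+ 3) by rewrite wE opprK.
      move=> x; rewrite /conn /den bE cE aE; congr (_ \in _); rewrite /= /mu /=.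
      by do 6?[congr (_ :: _)]; zmod.
    * by vm_compute.
(* Here [4 w = 0] makes [b] of order 12 with [a = 4 b]; otherwise [w] generates a cyclic group of
   order 12. *)
- have w6 : w *+ 6 != 0 by apply: (@ord_mod_neq0 w a); rewrite oE.
  case: wo' => wE.
  + right; exists b, a, c; split; first exact: perm3_bac.
    do 3!right; left; split; last by rewrite bE; apply: (zlin2 (-1) (-1) wE a3); zmod.
    have b4 : b *+ 4 = a by rewrite bE; apply: (zlin2 1 1 wE a3); zmod.
    have b6 : b *+ 6 = w *+ 6 by rewrite bE; apply: (zlin 2 a3); zmod.
    apply: order_eq => //=; last by rewrite b4 b6 a0 w6.
    by apply: (zlin2 3 1 b4 a3); zmod.
  + left; apply: (cyc_trivial (n := 12) (x := w)
      (L := [:: (4, 0); (-4, 0); (5, 0); (-5, 0); (3, 0); (-3, 0)])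
      (sts := [:: Conv 0 0 2; Conv 0 0 4; Conv 0 2 1; Conv 1 3 4])).
    * apply: order_eq => //=; last by rewrite wE w6 a0.
      by apply: (zlin2 3 1 wE a3); zmod.
    * move=> x; rewrite /conn /den bE cE -wE; congr (_ \in _); rewrite /= /mu /=.
      by do 6?[congr (_ :: _)]; zmod.
    * by vm_compute.
  + left; apply: (cyc_trivial (n := 12) (x := w)
      (L := [:: (-4, 0); (4, 0); (-3, 0); (3, 0); (-5, 0); (5, 0)])
      (sts := [:: Conv 0 0 2; Conv 0 0 4; Conv 0 2 1; Conv 1 3 4])).
    * apply: order_eq => //=; last by rewrite wE w6 oppr_eq0 a0.
      by apply: (zlin2 3 (-1) wE a3); zmod.
    * have aE : a = - (w *+ 4) by rewrite wE opprK.
      move=> x; rewrite /conn /den bE cE aE; congr (_ \in _); rewrite /= /mu /=.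
      by do 6?[congr (_ :: _)]; zmod.
    * by vm_compute.
Qed.

End DegenerateTriples.

(** * Invariant lines *)

Section Lines.
Variables (G : finZmodType) (S : pred G).
Hypothesis S_opp : forall x, S (- x) = S x.

(* Going [r] steps along a line of direction [c] ends, for odd [r], in the
   other layer of the double cover, above [r c]. *)
Lemma line_trivial (c d : G) r :
  tf_inv S true (fun x => x \in [:: c; - c]) -> tf_inv S false (pred1 d) ->
  c *+ 2 != 0 -> d *+ 2 = 0 -> odd r -> c *+ r = 0 \/ c *+ r = d ->
  tf_trivial S.
Proof.
move=> ic id c2 d2 r_odd rc f g fg x.
have gf := tf_sym S_opp fg; have [f_inj g_inj _] := fg.
have Nd : - d = d by apply: (zlin (-1) d2); zmod.
have [s sE gx] : exists2 s, s = c \/ s = - c & g (x + c) = f x + s.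
  have := ic _ _ fg x (x + c); rewrite addrAC subrr add0r mem_head /=.
  rewrite !inE !subr_eq => /orP[] /eqP->; [exists c|exists (- c)];
  by rewrite 1?addrC; auto.
pose h k := if odd k then g else f.
have h_inj k : injective (h k) by rewrite /h; case: (odd k).
have hS k y : h k.+1 (y + c) - h k y \in [:: s; - s].
  have -> : (h k.+1 (y + c) - h k y \in [:: s; - s]) =
            (h k.+1 (y + c) - h k y \in [:: c; - c]).
    by case: sE => ->; rewrite ?opprK // !inE orbC.
  have := ic _ _ fg y (y + c); have := ic _ _ gf y (y + c).
  rewrite addrAC subrr add0r mem_head /h /=.
  by case: (odd k).
(* The image walk starts with step [s] and each further step is [s] or [-s]; turning back would
   identify the images of two vertices that differ by [2 c], against injectivity. *)
have hE k : h k (x + c *+ k) = f x + s *+ k /\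
            h k.+1 (x + c *+ k.+1) = f x + s *+ k.+1.
  elim: k => [|k [IH0 IH1]]; first by rewrite !mulr0n !addr0.
  split=> //; have := hS k.+1 (x + c *+ k.+1).
  rewrite -addrA -mulrSr IH1 !inE !subr_eq => /orP[] /eqP hk.
    by rewrite hk [s *+ k.+2]mulrS addrCA.
  have : h k (x + c *+ k.+2) = h k (x + c *+ k).
    have hh : h k.+2 = h k by rewrite /h /= negbK.
    by rewrite IH0 -hh hk mulrS addrCA addKr.
  move/h_inj/addrI; rewrite -addn2 mulrnDr -[RHS]addr0 => /addrI ck.
  by rewrite ck eqxx in c2.
have := (hE r).1; rewrite /h r_odd.
have -> : s *+ r = c *+ r.
  by case: sE => -> //; rewrite mulNrn; case: rc => ->; rewrite ?oppr0 ?Nd.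
(* If [c *+ r = 0] the walk ends above its start, so [g x = f x]; if it ends at [d], then
   [g (x + d) = f x + d], and invariance of {d} gives [g (x + d) = g x + d]. *)
case: rc => ->; first by rewrite !addr0.
have /= := id _ _ gf x (x + d); rewrite addrAC subrr add0r eqxx.
by rewrite subr_eq [d + _]addrC => /eqP-> /addIr->.
Qed.
End Lines.

(** * Triples with 2x = 2y *)

Section DoubledTriples.
Variable G : finZmodType.
Implicit Types (a b c d x y z : G).

(** Coordinates of a, -a, b, -b, c, -c with respect to [a] and the involution [d = b - a]. *)
Definition grid_list : seq (int * int) :=
  [:: (1, 0); (-1, 0); (1, 1); (-1, 1); (-2, 1); (2, 1)].

Lemma conn_grid a b c d : d *+ 2 = 0 -> b = a + d -> c = - (a *+ 2) + d ->
  conn a b c =1 den a d grid_list.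
Proof.
move=> d2 -> -> x; rewrite /conn /den; congr (_ \in _); rewrite /= /mu /=.
do 6?[congr (_ :: _)]; try by zmod.
  by apply: (zlin (-1) d2); zmod.
by apply: (zlin (-1) d2); zmod.
Qed.

Lemma grid_trivial a b c d o sts : d != 0 -> d *+ 2 = 0 -> b = a + d ->
  c = - (a *+ 2) + d -> ord_mod d a = o -> a *+ o = 0 ->
  run_zero win_all (rel_grid o 2) grid_list sts -> tf_trivial (conn a b c).
Proof.
move=> d0 d2 bE cE oE ao; apply: run_zero_trivial (conn_grid d2 bE cE).
  exact: conn_opp.
exact: rel_gridP oE ao (order_2 d0 d2).
Qed.

Lemma mulrn_odd d k : d *+ 2 = 0 -> odd k -> d *+ k = d.
Proof.
move=> d2 k_odd.
by rewrite -[k]odd_double_half k_odd -mul2n mulrnDr mulrnA d2 mul0rn addr0.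
Qed.

Lemma ord_mod_shift d a : ord_mod d (a + d) = ord_mod d a.
Proof.
have dvd n : (ord_mod d (a + d)%R %| n)%N = (ord_mod d a %| n)%N.
  rewrite !ord_modE mulrnDl -FinRing.zmodMgE groupMr //.
  by rewrite -FinRing.zmodXgE mem_cycle.
by apply/eqP; rewrite eqn_dvd dvd dvdnn -dvd dvdnn.
Qed.

(** If [a *+ o] is [d] rather than 0, then [b *+ o = d + d = 0] because [o] is odd, and exchanging
    [a] and [b] restores the direct sum. *)
Lemma grid_trivial_odd a b c d o sts : d != 0 -> d *+ 2 = 0 -> b = a + d ->
  c = - (a *+ 2) + d -> ord_mod d a = o -> odd o ->
  run_zero win_all (rel_grid o 2) grid_list sts -> tf_trivial (conn a b c).
Proof.
move=> d0 d2 bE cE oE o_odd ok.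
have [j] := ord_modP a d; rewrite oE order_2 //.
case: j => [|[|//]] _ ao; first exact: grid_trivial oE ao ok.
apply: eq_tf_trivial (conn_swap a b c) _.
apply: (@grid_trivial b a c d o sts) => //.
- by rewrite bE; apply: (zlin (-1) d2); zmod.
- by rewrite cE bE; apply: (zlin 1 d2); zmod.
- by rewrite bE ord_mod_shift.
- by rewrite bE mulrnDl ao !(mulrn_odd d2) // -mulr2n d2.
Qed.

(** Let [o] be the order of [a] modulo [d = b - a]. Orders 1, 2, 3 are contradictory, 4 and 8 make 8
    divide the order of the group, 5, 6, 7 are settled by chains except when [6 a = d], which is
    exceptional, and above 8 the line argument applies to [c]. *)
Lemma decided_2x_2y a b c : triple a b c -> a *+ 2 = b *+ 2 -> decided a b c.
Proof.
move=> abc3 ab2; have [gen abc /and5P[ab aNb bc bNc /andP[ac aNc]]] := abc3.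
have [a0 b0 c0] := triple_neq0 abc3.
have [a2|a2] := eqVneq (a *+ 2) 0; first exact: decided_2x.
have [c2|c2] := eqVneq (c *+ 2) 0.
  apply: decided_perm (perm3_cab a b c) _.
  exact: decided_2x (triple_rot (triple_rot abc3)) c2.
have [G8|G8] := boolP (8 %| #|G|)%N.
  by right; exists a, b, c; split=> //; right; left.
have [d bE] : exists d, b = a + d by exists (b - a); rewrite addrC subrK.
have d2 : d *+ 2 = 0 by apply: (zlin (-1) ab2); rewrite bE; zmod.
have d0 : d != 0 by apply: contraNneq ab; rewrite bE => ->; rewrite addr0.
have od := order_2 d0 d2.
have cE : c = - (a *+ 2) + d.
  by rewrite bE in abc; apply: (zlin2 1 (-1) abc d2); zmod.
have [j lt_j ao] := ord_modP a d; rewrite od in lt_j.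
have {lt_j} ao : a *+ ord_mod d a = 0 \/ a *+ ord_mod d a = d.
  by case: j lt_j ao => [|[|//]] _ ->; [left|right].
have o_dvd := ord_mod_dvd d a; rewrite od in o_dvd.
have trivial_odd := grid_trivial_odd d0 d2 bE cE.
have [o_big|o_small] := ltnP 8 (ord_mod d a).
  left.
  (* Node 1 is {d}. Translation by [d] permutes a, -a, b, -b, but moves c and -c out of the
     connection set, so node 3 is {c, -c}. *)
  pose sts := [:: Conv 0 0 4; Conv 0 1 1; Diff 0 2].
  have nsP := run_inv (conn_opp a b c) (rel_stripP o_big od) sts _ (conn_grid d2 bE cE).
  pose ns := run (win_le 8) (rel_strip 2) grid_list sts.
  have n1 : nth (false, [::]) ns 1 = (false, [:: (0, 1)]) by vm_compute.
  have n3 : nth (false, [::]) ns 3 = (true, [:: (-2, 1); (2, 1)]) by vm_compute.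
  have id : tf_inv (conn a b c) false (pred1 d).
    have := nsP 1%N; rewrite n1.
    by apply: eq_tf_inv => x; rewrite /den inE /mu /= mulr0z add0r mulr1z.
  have ic : tf_inv (conn a b c) true (fun x => x \in [:: c; - c]).
    have := nsP 3%N; rewrite n3.
    apply: eq_tf_inv => x; rewrite /den cE; congr (_ \in _); rewrite /mu /=.
    do 2?[congr (_ :: _)].
    by apply: (zlin 1 d2); zmod.
  (* Let N be the index of the subgroup generated by [d]; 4 does not divide N. As [c = -2 a + d] and
     [N a] is 0 or [d], one may take N if it is odd and N/2 otherwise. *)
  have [r r_odd rc] : exists2 r, odd r & c *+ r = 0 \/ c *+ r = d.
    move: G8; rewrite (card_index d) od; have := index_mod d a.
    move: #|_ : _|%g => N /cycleE[k]; rewrite od => lt_k aN G8.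
    have [N_odd|N_even] := boolP (odd N).
      exists N; first by [].
      right.
      rewrite cE mulrnDl.
      rewrite (mulrn_odd d2 N_odd).
      rewrite mulNrn mulrnAC aN.
      by rewrite mulrnAC d2 mul0rn oppr0 add0r.
    have NE : N = (N./2 * 2)%N by rewrite muln2 -[LHS]odd_double_half (negbTE N_even).
    have half_odd : odd N./2.
      apply: contraR G8 => half_even.
      have [q ->] : exists q, N = (q * 2 * 2)%N.
        exists N./2./2; rewrite {1}NE; congr (_ * 2)%N.
        by rewrite muln2 -[LHS]odd_double_half (negbTE half_even).
      by rewrite -mulnA mulnCA dvdn_mull.
    exists N./2; first by [].
    rewrite cE mulrnDl (mulrn_odd d2 half_odd) mulNrn -mulrnA mulnC -NE aN.
    case: k lt_k {aN} => [|[|//]] _; first by rewrite mulr0n oppr0 add0r; right.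
    by rewrite mulr1n addNr; left.
  exact (line_trivial (conn_opp a b c) ic id c2 d2 r_odd rc).
have := ord_mod_gt0 a d; case oE: (ord_mod d a) o_small ao o_dvd trivial_odd =>
  [|[|[|[|[|[|[|[|[|//]]]]]]]]] // _ ao o_dvd trivial_odd _.
- case: ao => aE.
    by case/negP: a0; rewrite -[a]mulr1n aE.
  by case/negP: b0; rewrite bE -[a]mulr1n aE -mulr2n d2.
- case: ao => aE; first by rewrite aE eqxx in a2.
  by case/negP: aNb; rewrite bE; apply/eqP; apply: (zlin2 1 1 aE d2); zmod.
- case: ao => aE.
    by case/negP: bc; rewrite bE cE; apply/eqP; apply: (zlin 1 aE); zmod.
  by case/negP: ac; rewrite cE; apply/eqP; apply: (zlin 1 aE); zmod.
- by rewrite o_dvd in G8.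
- left; apply: (trivial_odd 5
    [:: Conv 0 0 2; Conv 0 0 3; Conv 0 2 1; Conv 1 3 2]); [by []|by []|].
  by vm_compute.
- case: ao => aE.
    left; apply: (grid_trivial (sts := [:: Conv 0 0 2; Conv 0 1 6]) d0 d2 bE cE oE aE).
    by vm_compute.
  right; exists a, c, b; split; first exact: perm3_acb.
  do 3!right; left; split; last by rewrite cE; apply: (zlin (-1) aE); zmod.
  apply: order_eq => //=.
    by rewrite -d2; apply: (zlin 2 aE); zmod.
  by rewrite aE d0 /= (@ord_mod_neq0 _ a d) // oE.
- left; apply: (trivial_odd 7
    [:: Conv 0 0 2; Conv 0 1 3; Conv 1 1 6; Conv 2 3 4]); [by []|by []|].
  by vm_compute.
- by rewrite (dvdn_trans _ o_dvd) in G8.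
Qed.

End DoubledTriples.

(** * Cyclic groups: triples with y = 2x or y = 3x *)

Section CyclicTriples.
Variable G : finZmodType.
Implicit Types (a b c d x y z : G).

Definition cyc_list (l : seq int) : seq (int * int) := [seq (i, 0) | i <- l].

(** Chains for {±1, ±2, ±3} in Z/n. The default branch serves all [n > 12]: its nodes are {±1}, {0,
    ±2} and {0}. *)
Definition chain_123 n :=
  match n with
  | 9 => [:: Conv 0 0 3; Conv 0 0 5; Conv 1 2 1; Conv 0 3 4]
  | 10 => [:: Conv 0 0 2; Conv 0 0 3; Conv 0 2 1; Conv 1 3 2]
  | 11 => [:: Conv 0 0 2; Conv 0 0 3; Conv 0 2 4; Conv 1 3 2]
  | 12 => [:: Conv 0 0 4; Conv 0 0 2; Conv 0 2 1; Conv 1 3 2]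
  | _ => [:: Conv 0 0 4; Conv 0 1 2; Diff 2 0]
  end%N.

(** Chains for {±1, ±3, ±4} in Z/n. The default branch serves 13, 15, 17 to 22, and all larger [n]
    at once through the window. *)
Definition chain_134 n :=
  match n with
  | 9 => [:: Conv 0 0 3; Conv 0 0 5; Conv 1 2 1; Conv 0 3 4]
  | 10 => [:: Conv 0 0 2; Conv 0 0 3; Conv 0 2 1; Conv 1 3 2]
  | 11 => [:: Conv 0 0 2; Conv 0 0 3; Conv 0 2 4; Conv 1 3 2]
  | 12 => [:: Conv 0 0 2; Conv 0 0 4; Conv 0 2 1; Conv 1 3 4]
  | 14 => [:: Conv 0 0 2; Conv 0 1 3; Conv 1 1 6; Conv 2 3 4]
  | _ => [:: Conv 0 0 2; Conv 0 1 6]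
  end%N.

Lemma chains_123 : all (fun n => run_zero win_all (rel_grid n 1)
  (cyc_list [:: 1; -1; 2; -2; -3; 3]) (chain_123 n)) (iota 9 4).
Proof. by vm_compute. Qed.

Lemma chain_123_strip : run_zero (win_le 12) (rel_strip 1)
  (cyc_list [:: 1; -1; 2; -2; -3; 3]) (chain_123 13).
Proof. by vm_compute. Qed.

(** The order 16 is left out: there the generator 4 has order 4, and the triple is exceptional. *)
Lemma chains_134 : all (fun n => (n == 16%N) || run_zero win_all (rel_grid n 1)
  (cyc_list [:: 1; -1; 3; -3; -4; 4]) (chain_134 n)) (iota 9 14).
Proof. by vm_compute. Qed.

Lemma chain_134_strip : run_zero (win_le 22) (rel_strip 1)
  (cyc_list [:: 1; -1; 3; -3; -4; 4]) (chain_134 23).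
Proof. by vm_compute. Qed.

(** The group is generated by [a], and the hypotheses force its order to be at least 7. Order 7
    gives a complete graph, in order 8 the element [b = 2 a] has order 4, and chains settle the
    rest. *)
Lemma decided_y_2x a b c : triple a b c -> b = a *+ 2 -> b *+ 2 != 0 -> c *+ 2 != 0 ->
  decided a b c.
Proof.
move=> abc3 bE b2 c2.
have [gen abc /and5P[ab aNb bc bNc /andP[ac aNc]]] := abc3.
have [a0 b0 c0] := triple_neq0 abc3.
have cE : c = - (a *+ 3) by rewrite bE in abc; apply: (zlin 1 abc); zmod.
have a1 : a *+ 1 != 0 by [].
have a2 : a *+ 2 != 0 by rewrite -bE.
have a3 : a *+ 3 != 0 by rewrite -oppr_eq0 -cE.
have a4 : a *+ 4 != 0 by move: b2; rewrite bE -mulrnA.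
have a5 : a *+ 5 != 0.
  apply: contraNneq bc => a5; rewrite bE cE; apply/eqP; apply: (zlin 1 a5); zmod.
have a6 : a *+ 6 != 0 by move: c2; rewrite cE mulNrn oppr_eq0 -mulrnA.
have connE : conn a b c =1 den a 0 (cyc_list [:: 1; -1; 2; -2; -3; 3]).
  move=> x; rewrite /conn /den bE cE; congr (_ \in _); rewrite /= /mu /=.
  by do 6?[congr (_ :: _)]; zmod.
have {a1 a2 a3 a4 a5 a6} n_ge : (6 < #[a]%g)%N.
  rewrite ltnNge; apply/negP => n_le; have := order_gt0 a.
  by move: n_le a1 a2 a3 a4 a5 a6; rewrite -!dvdn_orderE;
     case: #[a]%g => [|[|[|[|[|[|[|]]]]]]].
have [n_big|n_small] := ltnP 12 #[a]%g.
  left; apply: (run_zero_trivial (conn_opp a b c) (rel_stripP1 (erefl (0 : G)) n_big) connE).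
  exact: chain_123_strip.
have [n_ge9|n_lt9] := leqP 9 #[a]%g.
  left; apply: (cyc_trivial (erefl #[a]%g) connE).
  by apply: (allP chains_123); rewrite mem_iota n_ge9.
have [n8|n7] := eqVneq #[a]%g 8%N.
  right; exists b, a, c; split; [exact: perm3_bac|left; split].
    by rewrite bE -FinRing.zmodXgE orderXdiv n8.
  by rewrite -n8 -cardsT; apply: order_dvdG; rewrite in_setT.
have {n_ge n_lt9 n_small n7} n7 : #[a]%g = 7%N.
  by move: n_ge n_lt9 n7; case: #[a]%g => [|[|[|[|[|[|[|[|[|]]]]]]]]].
have a7 : a *+ 7 = 0 by rewrite -n7 -FinRing.zmodXgE expg_order.
left; apply: (complete_trivial abc3) => x.
have : x \in <[a]>%g.
  have [i [j ->]] := gen x; rewrite bE [a *+ 2]pmulrn -mulrzA -mulrzDr.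
  exact: mem_cyclez.
case/cycleE => k; rewrite n7 => lt_k -> ak; rewrite connE.
have -> : a *+ k = mu a 0 (k%:Z, 0) by rewrite /mu /= mulr0z addr0.
rewrite /den -(veq_has (rel_gridP1 (erefl (0 : G)) n7)) //.
by case: k lt_k ak => [|[|[|[|[|[|[|]]]]]]] //; rewrite eqxx.
Qed.

(** The hypotheses exclude all orders of [a] up to 8; order 16 is exceptional through [c = -4 a],
    and chains settle the others. *)
Lemma decided_y_3x a b c : triple a b c -> b = a *+ 3 -> a *+ 2 != 0 -> b *+ 2 != 0 ->
  c *+ 2 != 0 -> decided a b c.
Proof.
move=> abc3 bE a2 b2 c2.
have [gen abc /and5P[ab aNb bc bNc /andP[ac aNc]]] := abc3.
have [a0 b0 c0] := triple_neq0 abc3.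
have cE : c = - (a *+ 4) by rewrite bE in abc; apply: (zlin 1 abc); zmod.
have a1 : a *+ 1 != 0 by [].
have a3 : a *+ 3 != 0 by rewrite -bE.
have a4 : a *+ 4 != 0 by rewrite -oppr_eq0 -cE.
have a5 : a *+ 5 != 0.
  by apply: contraNneq ac => a5; rewrite cE; apply/eqP; apply: (zlin 1 a5); zmod.
have a6 : a *+ 6 != 0 by move: b2; rewrite bE -mulrnA.
have a7 : a *+ 7 != 0.
  by apply: contraNneq bc => a7; rewrite bE cE; apply/eqP; apply: (zlin 1 a7); zmod.
have a8 : a *+ 8 != 0 by move: c2; rewrite cE mulNrn oppr_eq0 -mulrnA.
have connE : conn a b c =1 den a 0 (cyc_list [:: 1; -1; 3; -3; -4; 4]).
  move=> x; rewrite /conn /den bE cE; congr (_ \in _); rewrite /= /mu /=.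
  by do 6?[congr (_ :: _)]; zmod.
have {a1 a2 a3 a4 a5 a6 a7 a8} n_ge : (8 < #[a]%g)%N.
  rewrite ltnNge; apply/negP => n_le; have := order_gt0 a.
  by move: n_le a1 a2 a3 a4 a5 a6 a7 a8; rewrite -!dvdn_orderE;
     case: #[a]%g => [|[|[|[|[|[|[|[|[|]]]]]]]]].
have [n_big|n_small] := ltnP 22 #[a]%g.
  left; apply: (run_zero_trivial (conn_opp a b c) (rel_stripP1 (erefl (0 : G)) n_big) connE).
  exact: chain_134_strip.
have := allP chains_134 #[a]%g; rewrite mem_iota n_ge ltnS n_small => /(_ isT).
case/orP => [/eqP n16|ok]; last by left; exact (cyc_trivial (erefl #[a]%g) connE ok).
right; exists c, a, b; split; [exact: perm3_cab|left; split].
  by rewrite cE -FinRing.zmodVgE orderV -FinRing.zmodXgE orderXdiv n16.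
by apply: (@dvdn_trans 16) => //; rewrite -n16 -cardsT; apply: order_dvdG; rewrite in_setT.
Qed.

End CyclicTriples.

(** * The generic triples *)

Section GenericTriples.
Variable G : finZmodType.
Definition axes : seq (int * int) := [:: (1, 0); (0, 1); (-1, -1)].
Definition vopp (p : int * int) : int * int := (- p.1, - p.2).
Definition vscale (i : int) (p : int * int) : int * int := (i * p.1, i * p.2).
(** The connection set lifted to Z x Z: the six directions of the triangular lattice. *)
Definition hexagon := axes ++ map vopp axes.

(* The relations [i x + j y = 0] between two of the three generators that are
   excluded for a generic triple. *)
Definition generic_forms : seq (int * int) :=
  [:: (1, 0); (1, -1); (2, 0); (3, 0); (2, -2); (2, -1); (3, -1)].

(** The excluded forms, with both signs, evaluated at all ordered pairs of distinct generators;
    genericity makes their images nonzero. *)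
Definition generic_window : seq (int * int) :=
  [seq vadd (vscale p.1 w.1) (vscale p.2 w.2)
    | p <- generic_forms ++ map vopp generic_forms,
      w <- [seq (u, v) | u <- axes, v <- [seq v <- axes | v != u]]].

(** The finite check behind [S_sum]: two sums that differ nontrivially in Z x Z differ by a vector
    of the window, hence also in the group. *)
Lemma hexagon_sums : all (fun p => all (fun q => all (fun p1 => all (fun q1 =>
  [|| p == q, p == vopp q, (p1 == p) && (q1 == q), (p1 == q) && (q1 == p)
    | vsub (vadd p q) (vadd p1 q1) \in generic_window])
  hexagon) hexagon) hexagon) hexagon.
Proof. by vm_compute. Qed.

Lemma hexagon_doubles : all (fun p => all (fun q =>
  [|| p == q, p == vopp q | vsub (vadd p p) (vadd q q) \in generic_window])
  hexagon) hexagon.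
Proof. by vm_compute. Qed.

Lemma hexagon_neq0 : all (fun p => (p \in generic_window) &&
  (vadd p p \in generic_window)) hexagon.
Proof. by vm_compute. Qed.

(** Such vectors are ±a, ±b, ±c in some order: equal signs give sum 0, and a single summand [z] of
    deviating sign gives [2 z]. *)
Lemma hexagon_triples : all (fun p => all (fun q => all (fun r =>
  [|| p == q, p == vopp q, p == r, p == vopp r, q == r, q == vopp r,
      vadd p (vadd q r) == (0, 0)
    | vadd p (vadd q r) \in [seq vadd z z | z <- hexagon]])
  hexagon) hexagon) hexagon.
Proof. by vm_compute. Qed.

Variables a b c : G.
Hypothesis abc3 : triple a b c.
Hypothesis generic : forall x y z, perm_eq [:: x; y; z] [:: a; b; c] ->
  [/\ x *+ 2 != 0, x *+ 3 != 0, x *+ 2 != y *+ 2, y != x *+ 2 & y != x *+ 3].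

Local Notation S := (conn a b c).
Local Notation mu := (mu a b).

Let S_opp := conn_opp a b c.

Lemma mu_axes : map mu axes = [:: a; b; c].
Proof.
have [_ abc _] := abc3; rewrite /= /mu /=.
do 3?[congr (_ :: _)]; try by zmod.
by apply: (zlin (-1) abc); zmod.
Qed.

Lemma mu_opp p : mu (vopp p) = - mu p.
Proof. by rewrite /mu /= !mulrNz opprD. Qed.

Lemma mu_scale i p : mu (vscale i p) = mu p *~ i.
Proof. by rewrite /mu mulrzDl -!mulrzA ![_ * i]mulrC. Qed.

Lemma generic_mu p : p \in generic_window -> mu p != 0.
Proof.
have [ma mb mc] : [/\ mu (1, 0) = a, mu (0, 1) = b & mu (-1, -1) = c].
  by have := mu_axes => -[].
have neq0 u v : u \in axes -> v \in axes -> v != u ->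
    forall q, q \in generic_forms -> mu u *~ q.1 + mu v *~ q.2 != 0.
  move=> uA vA uv; have [z pe] : exists z, perm_eq [:: mu u; mu v; z] [:: a; b; c].
    move: uA vA uv; rewrite !inE => /or3P[]/eqP-> /or3P[]/eqP-> //= _;
    rewrite ?ma ?mb ?mc.
    + by exists c.
    + exists b; exact: perm3_acb.
    + exists c; exact: perm3_bac.
    + exists a; exact: perm3_bca.
    + exists b; exact: perm3_cab.
    + exists a; exact: perm3_cba.
  have [x2 x3 xy2 xy xy3] := generic pe.
  have [_ _ /and5P[nxy _ _ _ _]] := triple_perm pe abc3.
  have [x0 _ _] := triple_neq0 (triple_perm pe abc3).
  move=> q; rewrite !inE => /or4P[|||/or4P[]] /eqP-> /=.
  - by rewrite mulr0z addr0 mulr1z.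
  - by rewrite mulr1z mulrN1z subr_eq0.
  - by rewrite mulr0z addr0.
  - by rewrite mulr0z addr0.
  - by apply: contraNneq xy2 => h; apply/eqP; apply: (zlin 1 h); zmod.
  - by apply: contraNneq xy => h; apply/eqP; apply: (zlin (-1) h); zmod.
  - by apply: contraNneq xy3 => h; apply/eqP; apply: (zlin (-1) h); zmod.
case/allpairsP => qw [qF wW ->]; have [u [v [uA vA wE]]] := elimT allpairsPdep wW.
move: vA; rewrite mem_filter => /andP[vu vA]; rewrite muD !mu_scale wE.
have {}neq0 := neq0 u v uA vA vu.
move: qF; rewrite mem_cat => /orP[/neq0|/mapP[q /neq0 + ->]] //.
by rewrite /= !mulrNz -opprD oppr_eq0.
Qed.

Lemma S_hexagonE x : S x = (x \in map mu hexagon).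
Proof.
have -> : S x = (x \in map mu axes ++ map -%R (map mu axes)).
  rewrite mu_axes /conn !inE.
  by move: (x == a) (x == - a) (x == b) (x == - b) (x == c) (x == - c)
    => [] [] [] [] [] [].
by rewrite -map_comp -(eq_map mu_opp) map_comp -map_cat.
Qed.

Lemma S_mu p : p \in hexagon -> S (mu p).
Proof. by rewrite S_hexagonE; exact: map_f. Qed.

Lemma S_hexagon x : S x -> exists2 p, p \in hexagon & x = mu p.
Proof. by rewrite S_hexagonE => /mapP. Qed.

Lemma S_neq0 s : S s -> s != 0.
Proof.
case/S_hexagon => p pH ->.
by have /andP[/generic_mu] := allP hexagon_neq0 p pH.
Qed.

Lemma S_double s : S s -> s *+ 2 != 0.
Proof.
case/S_hexagon => p pH ->; rewrite mulr2n -muD.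
by have /andP[_ /generic_mu] := allP hexagon_neq0 p pH.
Qed.

Lemma S_sum s t s1 t1 : S s -> S t -> S s1 -> S t1 -> s != t -> s != - t ->
  s + t = s1 + t1 -> (s1 = s /\ t1 = t) \/ (s1 = t /\ t1 = s).
Proof.
case/S_hexagon => p pH ->; case/S_hexagon => q qH ->.
case/S_hexagon => p1 p1H ->; case/S_hexagon => q1 q1H ->.
have /or4P[/eqP->|/eqP->|/andP[/eqP-> /eqP->]|] :=
  allP (allP (allP (allP hexagon_sums p pH) q qH) p1 p1H) q1 q1H.
- by rewrite eqxx.
- by rewrite mu_opp => _; rewrite eqxx.
- by left.
case/orP => [/andP[/eqP-> /eqP->]|/generic_mu +]; first by right.
by rewrite muB !muD subr_eq0 => /eqP.
Qed.

Lemma S_doubles s t : S s -> S t -> s *+ 2 = t *+ 2 -> s = t \/ s = - t.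
Proof.
case/S_hexagon => p pH ->; case/S_hexagon => q qH ->; rewrite !mulr2n -!muD.
have /or3P[/eqP->|/eqP->|/generic_mu] := allP (allP hexagon_doubles p pH) q qH.
- by left.
- by right; rewrite mu_opp.
- by rewrite muB subr_eq0 => /eqP.
Qed.

Lemma exceptional_4 z : S z -> #[z]%g = 4%N ->
  ~~ odd #|[set: G] : <[z]>|%g -> exceptional a b c.
Proof.
move=> Sz oz N_even.
have G8 : (8 %| #|G|)%N.
  by rewrite (card_index z) oz -[8%N]/(4 * 2)%N dvdn_mul // dvdn2.
have orderN (y : G) : #[- y]%g = #[y]%g by rewrite -FinRing.zmodVgE orderV.
move: Sz; rewrite /conn !inE => /or4P[|||/or3P[]] /eqP zE;
  move: oz; rewrite zE ?orderN => oz;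
  [exists a, b, c|exists a, b, c|exists b, a, c|exists b, a, c
  |exists c, a, b|exists c, a, b];
  by split; rewrite ?perm3_cab ?perm3_bac //; left.
Qed.

Hypothesis not_exceptional : ~ exceptional a b c.

Lemma order_4 z : S z -> z *+ 4 = 0 -> #[z]%g = 4%N.
Proof.
by move=> Sz z4; apply: order_eq; rewrite //= (S_double Sz).
Qed.

Lemma index_odd z : S z -> z *+ 4 = 0 -> odd #|[set: G] : <[z]>|%g.
Proof.
move=> Sz z4; apply/negPn/negP => N_even; apply: not_exceptional.
by apply: exceptional_4 N_even => //; exact: order_4.
Qed.

(** The subgroup generated by [s] has odd index, so an odd multiple of [t] lies in it, and with
    [4 t = 0] so does [t]; its only elements of order 4 are [s] and [-s]. *)
Lemma S_order4_unique s t : S s -> S t -> s *+ 4 = 0 -> t *+ 4 = 0 ->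
  t = s \/ t = - s.
Proof.
move=> Ss St s4 t4; have := index_odd Ss s4.
have := index_mod s t; move: #|_ : _|%g => N /cycleE[k].
rewrite (order_4 Ss s4) => lt_k tN N_odd.
have : t \in <[s]>%g.
  have : t *+ N \in <[s]>%g by rewrite tN -FinRing.zmodXgE mem_cycle.
  have t22 : t *+ 2 *+ 2 = 0 by rewrite -mulrnA.
  rewrite -[N]odd_double_half N_odd -mul2n mulrnDr mulr1n mulrnA.
  have [/(mulrn_odd t22) ->|half_even] := boolP (odd N./2).
    suff -> : t + t *+ 2 = (t^-1)%g by rewrite groupV.
    by rewrite FinRing.zmodVgE; apply: (zlin 1 t4); zmod.
  rewrite -[N./2]odd_double_half (negbTE half_even) -mul2n.
  by rewrite add0n mulrnA t22 mul0rn addr0.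
case/cycleE => j; rewrite (order_4 Ss s4).
case: j => [|[|[|[|//]]]] _ tE.
- by have := S_neq0 St; rewrite tE eqxx.
- by left.
- by have := S_double St; rewrite tE -mulrnA s4 eqxx.
- by right; rewrite tE; apply: (zlin 1 s4); zmod.
Qed.

(** By genericity another representation would have the form [t + t] with [t = -s], which [4 s != 0]
    excludes. With [nconv_diff] this tells pairs of opposite directions from other pairs. *)
Lemma nconv_double s : S s -> s *+ 4 != 0 -> nconv S S (s *+ 2) = 1%N.
Proof.
move=> Ss s4; rewrite -[RHS](card1 s); apply: eq_card => t; rewrite !inE.
apply/andP/eqP => [[St]|->]; last by split; rewrite // mulr2n addrK.
set r := _ - t => Sr.
have tr : t + r = s + s by rewrite addrC subrK mulr2n.
have [tr_eq|tNr] := eqVneq t r.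
  rewrite -{}tr_eq in tr; have tt : t *+ 2 = s *+ 2 by rewrite !mulr2n.
  have [//|tE] := S_doubles St Ss tt.
  by case/eqP: s4; rewrite tE in tr; apply: (zlin (-1) tr); zmod.
have [tr_opp|tNNr] := eqVneq t (- r).
  by have := S_double Ss; rewrite mulr2n -tr tr_opp addNr eqxx.
have [[st sr]|[sr st]] := S_sum St Sr Ss Ss tNr tNNr tr; first by rewrite st.
by rewrite st.
Qed.

Lemma nconv_diff s t : S s -> S t -> s != t -> s != - t ->
  (1 < nconv S S (s - t)%R)%N.
Proof.
move=> Ss St st sNt.
have /subset_leq_card : [pred x | x \in [:: s; - t]] \subset
    [pred x | S x && S (s - t - x)].
  apply/subsetP => x; rewrite !inE => /orP[] /eqP->.
    by rewrite Ss addrAC subrr add0r S_opp.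
  by rewrite S_opp St opprK subrK.
rewrite (_ : #|_| = 2%N) //.
by rewrite (card_uniqP _) //= inE sNt.
Qed.

(** The direction of the image of the edge leaving [x] in direction [s], from the layer of [f] to
    that of [g]. *)
Definition dir (f g : G -> G) x s := g (x + s) - f x.

Lemma dirE f g x s : g (x + s) = f x + dir f g x s.
Proof. by rewrite /dir addrCA subrr addr0. Qed.

Lemma S_dir f g x s : tf S f g -> S (dir f g x s) = S s.
Proof. by case=> _ _ fg; rewrite /dir fg addrAC subrr add0r. Qed.

Lemma dir_inj f g x : tf S f g -> injective (dir f g x).
Proof. by case=> _ g_inj _ s t /addIr/g_inj/addrI. Qed.

Lemma dir_surj f g x r : tf S f g -> S r -> exists2 s, S s & dir f g x s = r.
Proof.
move=> fg Sr; have [_ g_inj _] := fg; have [g' gK g'K] := injF_bij g_inj.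
have rE : dir f g x (g' (f x + r) - x) = r.
  by rewrite /dir addrCA subrr addr0 g'K addrAC subrr add0r.
by exists (g' (f x + r) - x); rewrite // -(S_dir x _ fg) rE.
Qed.

Lemma nconv_dir f g x s t : tf S f g ->
  nconv S S (dir f g x s - dir f g x t) = nconv S S (s - t).
Proof.
move=> fg; rewrite /dir opprB addrA addrNK.
have := tf_inv_conv S_opp (nconv S S (s - t)) (@tf_inv_S _ S) (@tf_inv_S _ S).
move=> /(_ _ _ (tf_sym S_opp fg) (x + t) (x + s)) /=.
by rewrite opprD addrACA subrr add0r eqxx => /eqP.
Qed.

(** If [4 s != 0], the element [s - (-s)] has one representation, whereas the difference of two
    distinct, non-opposite directions has at least two. If [4 s = 0], the direction [t] sent to the
    opposite of the image of [s] is [-s], by the first case or by [S_order4_unique]. *)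
Lemma dir_opp f g x s : tf S f g -> S s -> dir f g x (- s) = - dir f g x s.
Proof.
move=> fg; have dirN t : S t -> t *+ 4 != 0 -> dir f g x (- t) = - dir f g x t.
  move=> St t4; have := nconv_dir x t (- t) fg.
  rewrite opprK -mulr2n nconv_double // => n1.
  have Sd := S_dir x t fg; have SdN := S_dir x (- t) fg.
  rewrite S_opp St in SdN; rewrite St in Sd.
  apply/eqP/negPn/negP; rewrite eqN_sym => dN.
  suff /(nconv_diff Sd SdN)/(_ dN) : dir f g x t != dir f g x (- t) by rewrite n1.
  rewrite (inj_eq (dir_inj fg)); apply: contraNneq (S_double St) => tE.
  by rewrite mulr2n {2}tE subrr.
move=> Ss; have [s4|] := eqVneq (s *+ 4) 0; last exact: dirN.
have Sd : S (- dir f g x s) by rewrite S_opp S_dir.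
have [t St tE] := dir_surj x fg Sd.
have [t4|t4] := eqVneq (t *+ 4) 0.
  have [ts|<- //] := S_order4_unique Ss St s4 t4.
  have Sds : S (dir f g x s) by rewrite S_dir.
  have := S_double Sds; rewrite mulr2n -{1}[dir f g x s]opprK -tE ts addNr eqxx //.
have := dirN t St t4; rewrite tE opprK => /(dir_inj fg) tNs.
by rewrite -tE -tNs opprK.
Qed.

(** The image of the 4-cycle through x, x + s, x + s + t, x + t closes up. By [S_sum] either
    parallel edges keep a common direction, or [f (x + s + t) = f x], which means [t = -s]. *)
Lemma dir_step f g x s t : tf S f g -> S s -> S t ->
  dir g f (x + s) t = dir f g x t.
Proof.
move=> fg; have gf := tf_sym S_opp fg; have [f_inj g_inj _] := fg.
move=> Ss St.
have back : dir g f (x + s) (- s) = dir f g x (- s).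
  by rewrite [RHS]dir_opp // /dir addrK opprB.
have [->|ts] := eqVneq t s.
  apply: oppr_inj; rewrite -!dir_opp //.
have [->//|tNs] := eqVneq t (- s).
pose r := f (x + s + t) - f x.
have Sd u : S u -> S (dir f g x u) by rewrite S_dir.
have pE : dir g f (x + s) t = r - dir f g x s by rewrite /r /dir; zmod.
have stE : x + t + s = x + s + t by rewrite addrAC.
have qE : dir g f (x + t) s = r - dir f g x t by rewrite /r /dir stE; zmod.
have Sp : S (dir g f (x + s) t) by rewrite S_dir.
have Sq : S (dir g f (x + t) s) by rewrite S_dir.
have sum_eq : dir f g x s + - dir f g x t = dir g f (x + t) s + - dir g f (x + s) t.
  by rewrite pE qE; zmod.
have SNt : S (- dir f g x t) by rewrite S_opp Sd.
have SNp : S (- dir g f (x + s) t) by rewrite S_opp.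
have [||[_ /oppr_inj //]|[qNt pNs]] := S_sum (Sd _ Ss) SNt Sq SNp _ _ sum_eq.
- by rewrite -dir_opp // (inj_eq (dir_inj fg)) eqN_sym.
- by rewrite opprK (inj_eq (dir_inj fg)) eq_sym.
have r0 : r = 0 by apply: (zlin 1 qNt); rewrite qE; zmod.
have /f_inj/eqP : f (x + s + t) = f x by apply: (zlin 1 r0); rewrite /r; zmod.
rewrite -addrA -subr_eq0 addrAC subrr add0r addr_eq0 eqN_sym => /eqP tE.
by rewrite tE eqxx in tNs.
Qed.

Lemma S_ind (P : G -> Prop) :
  P 0 -> (forall x s, S s -> P x -> P (x + s)) -> forall x, P x.
Proof.
move=> P0 PS; have [gen _ _] := abc3.
have [Sa Sb] : S a /\ S b by rewrite /conn !inE !eqxx ?orbT.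
have PM s k x : S s -> P x -> P (x + s *+ k).
  move=> Ss Px; elim: k => [|k IH]; first by rewrite addr0.
  by rewrite mulrSr addrA; exact: PS.
have PZ s (k : int) x : S s -> P x -> P (x + s *~ k).
  move=> Ss Px; case: k => k; first exact: PM.
  by rewrite NegzE mulrNz -mulNrz; apply: PM; rewrite ?S_opp.
move=> x; have [i [j ->]] := gen x; rewrite -[_ *~ i]add0r.
exact (PZ _ _ _ Sb (PZ _ _ _ Sa P0)).
Qed.

(** Three steps around the triangle return to the same point in the other layer, so the direction
    does not depend on the layer; connectedness then removes the dependence on [x]. *)
Lemma dir_const f g x s : tf S f g -> S s ->
  dir g f x s = dir f g x s /\ dir f g x s = dir f g 0 s.
Proof.
move=> fg Ss; have gf := tf_sym S_opp fg.
have [_ abc _] := abc3.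
have [Sa Sb Sc] : [/\ S a, S b & S c] by rewrite /conn !inE !eqxx ?orbT.
have swap y : dir g f y s = dir f g y s.
  rewrite -{1}(addr0 y) -abc !addrA (dir_step _ fg) //.
  by rewrite (dir_step _ gf) // (dir_step _ fg).
split=> //; move: x; apply: S_ind => // y t St IH.
by rewrite -[LHS]swap (dir_step _ fg).
Qed.

Lemma S_split z : S z -> exists p q, [/\ S p, S q, p + q + z = 0 &
  forall s, S s -> s \in [:: p; - p; q; - q; z; - z]].
Proof.
have [_ abc _] := abc3.
have [Sa Sb Sc] : [/\ S a, S b & S c] by rewrite /conn !inE !eqxx ?orbT.
have pos x y w : perm_eq [:: x; y; w] [:: a; b; c] -> x + y + w = 0 ->
    [/\ S x, S y, x + y + w = 0 & forall s, S s -> s \in [:: x; - x; y; - y; w; - w]].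
  move=> pe xyw; have cE := conn_perm pe.
  by split=> // [||s]; rewrite -cE // /conn !inE !eqxx ?orbT.
have neg x y w : [/\ S x, S y, x + y + w = 0 &
      forall s, S s -> s \in [:: x; - x; y; - y; w; - w]] ->
    [/\ S (- x), S (- y), - x - y - w = 0 &
      forall s, S s -> s \in [:: - x; - - x; - y; - - y; - w; - - w]].
  move=> [Sx Sy xyw S_eq]; rewrite !S_opp; split=> //.
    by rewrite -!opprD xyw oppr0.
  move=> s /S_eq; rewrite !opprK !inE.
  by move: (s == x) (s == - x) (s == y) (s == - y) (s == w) (s == - w)
    => [] [] [] [] [] [].
rewrite {1}/conn !inE => /or4P[|||/or3P[]] /eqP->.
- exists b, c; apply: pos; [exact: perm3_bca|by rewrite addrC addrA].
- exists (- b), (- c); apply: neg; apply: pos; [exact: perm3_bca|by rewrite addrC addrA].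
- exists c, a; apply: pos; [exact: perm3_cab|by rewrite -addrA addrC].
- exists (- c), (- a); apply: neg; apply: pos; [exact: perm3_cab|by rewrite -addrA addrC].
- by exists a, b; apply: pos.
- by exists (- a), (- b); apply: neg; apply: pos.
Qed.

Lemma generic_trivial : tf_trivial S.
Proof.
move=> f g fg; have gf := tf_sym S_opp fg; have [f_inj g_inj _] := fg.
have [_ abc _] := abc3.
have [Sa Sb Sc] : [/\ S a, S b & S c] by rewrite /conn !inE !eqxx ?orbT.
pose sg s := dir f g 0 s.
have gE x s : S s -> g (x + s) = f x + sg s.
  by move=> Ss; rewrite (dirE f g) (dir_const x fg Ss).2.
have fE x s : S s -> f (x + s) = g x + sg s.
  by move=> Ss; rewrite (dirE g f) (dir_const x fg Ss).1 (dir_const x fg Ss).2.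
pose e := sg a + sg b + sg c.
have gfE x : g x = f x + e.
  have xE : x = x + a + b + c by rewrite -[LHS]addr0 -abc !addrA.
  by rewrite {1}xE (gE _ _ Sc) (fE _ _ Sb) (gE _ _ Sa) /e !addrA.
have fgE x : f x = g x + e.
  have xE : x = x + a + b + c by rewrite -[LHS]addr0 -abc !addrA.
  by rewrite {1}xE (fE _ _ Sc) (gE _ _ Sb) (fE _ _ Sa) /e !addrA.
have e2 : e *+ 2 = 0.
  by have := gfE 0; rewrite {1}fgE -addrA -{1}[g 0]addr0 => /addrI/esym; rewrite mulr2n.
have [e0|e_neq0] := eqVneq e 0; first by move=> x; rewrite gfE e0 addr0.
have Ssg s : S s -> S (sg s) by rewrite /sg S_dir.
have sg_opp s : S s -> sg (- s) = - sg s by exact: dir_opp.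
have sg_inj : injective sg by exact: dir_inj.
(* The images of a, b, c are pairwise distinct and non-opposite, so their nonzero sum is twice an
   element of the connection set. *)
have [z Sz ze] : exists2 z, S z & e = z *+ 2.
  have neq s t : S t -> s != t -> s != - t -> sg s != sg t /\ sg s != - sg t.
    by move=> St st sNt; rewrite -sg_opp // !(inj_eq sg_inj).
  have [_ _ /and5P[ab aNb bc bNc /andP[ac aNc]]] := abc3.
  have [] := neq a b Sb ab aNb; have [] := neq b c Sc bc bNc; have [] := neq a c Sc ac aNc.
  have [p pH pE] := S_hexagon (Ssg _ Sa); have [q qH qE] := S_hexagon (Ssg _ Sb).
  have [r rH rE] := S_hexagon (Ssg _ Sc).
  have eE : e = mu (vadd p (vadd q r)) by rewrite /e pE qE rE !muD [RHS]addrA.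
  rewrite pE qE rE.
  move=> [/negbTE h1 /negbTE h2] [/negbTE h3 /negbTE h4] [/negbTE h5 /negbTE h6].
  have := allP (allP (allP hexagon_triples p pH) q qH) r rH.
  case/or4P => [/eqP pq|/eqP pq|/eqP pr|/or4P[/eqP pr|/eqP qr|/eqP qr|/orP[/eqP pqr|]]].
  - by rewrite pq eqxx in h5.
  - by rewrite pq mu_opp eqxx in h6.
  - by rewrite pr eqxx in h1.
  - by rewrite pr mu_opp eqxx in h2.
  - by rewrite qr eqxx in h3.
  - by rewrite qr mu_opp eqxx in h4.
  - by rewrite eE pqr /mu /= !mulr0z addr0 eqxx in e_neq0.
  - by case/mapP => z zH zE; exists (mu z); rewrite ?S_mu // eE zE muD mulr2n.
have z4 : z *+ 4 = 0 by rewrite -e2 ze -mulrnA.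
have := index_odd Sz z4; have := fun x => index_mod z x.
move: #|_ : _|%g => N modN N_odd; exfalso.
(* [phi] is a homomorphism into {0, e}, since [N s] is a multiple of [z]. As [phi z = e] and
   [p + q + z = 0], exactly one pair of opposite directions lies in its kernel. *)
pose phi (s : G) := s *+ N *+ 2.
have phiz : phi z = e by rewrite /phi -mulrnA mulnC mulrnA -ze (mulrn_odd e2).
have phiN s : phi (- s) = - phi s by rewrite /phi !mulNrn.
have phi_e s : phi s = 0 \/ phi s = e.
  have /cycleE[k _ sN] := modN s.
  rewrite /phi sN -mulrnA mulnC mulrnA -ze.
  have [/(mulrn_odd e2)->|k_even] := boolP (odd k); first by right.
  left; rewrite -[k]odd_double_half (negbTE k_even) add0n -mul2n mulrnA e2.
  by rewrite mul0rn.
have [p Sp [phip uniq_p]] : exists2 p, S p &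
    phi p = 0 /\ forall s, S s -> phi s = 0 -> s = p \/ s = - p.
  have [p [q [Sp Sq pqz S_eq]]] := S_split Sz.
  have phi_sum : phi p + phi q + e = 0.
    by rewrite -phiz /phi -!mulrnDl pqz !mul0rn.
  have Ne : - e = e by apply: (zlin (-1) e2); zmod.
  have split_zero p' q' : S p' -> phi p' = 0 -> phi q' = e ->
      (forall s, S s -> s \in [:: p'; - p'; q'; - q'; z; - z]) ->
      exists2 p, S p & phi p = 0 /\ forall s, S s -> phi s = 0 -> s = p \/ s = - p.
    move=> Sp' phip' phiq' S_eq'; exists p' => //; split=> // s /S_eq'.
    rewrite !inE => /or4P[/eqP->|/eqP->|/eqP->|/or3P[]/eqP->]; auto;
    rewrite ?phiN ?phiq' ?phiz ?Ne => e0; by rewrite e0 eqxx in e_neq0.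
  case: (phi_e p) => phip.
    apply: (split_zero p q) => //.
    by move: phi_sum; rewrite phip add0r => /addr0_eq qe; rewrite -Ne -qe opprK.
  apply: (split_zero q p) => //.
    by move: phi_sum; rewrite phip addrAC -mulr2n e2 add0r.
  by move=> s /S_eq; rewrite !inE; do 4!case: (s == _).
have fM m : f (p *+ m) = f 0 + (sg p + e) *+ m.
  elim: m => [|m IH]; first by rewrite !mulr0n addr0.
  rewrite !mulrSr fE // gfE IH -addrA [RHS]addrA; congr (_ + _); exact: addrC.
(* Walking [2 N] steps along [p] returns to the start because [phi p = 0], so [phi (sg p) = 0]
   too. *)
have sgp : sg p = p \/ sg p = - p.
  apply: uniq_p; first exact: Ssg.
  have := fM (N * 2)%N; rewrite {1}mulrnA -/(phi p) phip -{1}[f 0]addr0 => /addrI.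
  rewrite mulrnDl mulrnA -/(phi (sg p)) mulnC mulrnA e2 mul0rn addr0.
  by move=> ->.
have Np : - (p *+ N) = p *+ N.
  by move: phip; rewrite /phi; move: (p *+ N) => y y2; apply: (zlin (-1) y2); zmod.
have fN : f (p *+ N) = f 0 + p *+ N + e.
  rewrite fM mulrnDl (mulrn_odd e2) // addrA; congr (_ + _ + _).
  by case: sgp => ->; rewrite // mulNrn.
have /cycleE[k lt_k pN] := modN p.
(* Now [N p] is killed by 2 and lies in the subgroup generated by [z]. By [fN], the value 0 forces
   [e = 0], and the value [e] forces [f e = f 0]. *)
have [pN0|pNe] : p *+ N = 0 \/ p *+ N = e.
  move: phip; rewrite /phi pN; rewrite (order_4 Sz z4) in lt_k.
  case: k lt_k {pN} => [|[|[|[|//]]]] _; rewrite -?mulrnA.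
  - by left.
  - by rewrite -ze => /eqP; rewrite (negbTE e_neq0).
  - by right; rewrite ze.
  - by rewrite -[(3 * 2)%N]/(4 + 2)%N mulrnDr z4 add0r -ze => /eqP; rewrite (negbTE e_neq0).
- move: fN; rewrite pN0 addr0 -{1}[f 0]addr0 => /addrI/esym/eqP.
  by rewrite (negbTE e_neq0).
- move: fN; rewrite pNe -addrA -mulr2n e2 addr0 => /f_inj/eqP.
  by rewrite (negbTE e_neq0).
Qed.

End GenericTriples.

(** * Case distinction and passage to stability *)

Section Classification.
Variable G : finZmodType.
Implicit Types (a b c x y z : G).

(** Listing the six orderings turns statements up to permutation into boolean searches. *)
Definition orderings a b c : seq (G * G * G) :=
  [:: (a, b, c); (b, c, a); (c, a, b); (b, a, c); (a, c, b); (c, b, a)].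

Lemma mem_orderings a b c x y z :
  ((x, y, z) \in orderings a b c) = perm_eq [:: x; y; z] [:: a; b; c].
Proof.
apply/idP/idP => [|pe].
  rewrite !inE => /or4P[|||/or3P[]] /eqP[-> -> ->];
  by rewrite ?perm3_bca ?perm3_cab ?perm3_bac ?perm3_acb ?perm3_cba.
apply: (perm3_ind _ _ pe (P := fun x y z => (x, y, z) \in orderings a b c)).
- by move=> u v w; rewrite !inE => /or4P[|||/or3P[]] /eqP[-> -> ->]; rewrite eqxx ?orbT.
- by move=> u v w; rewrite !inE => /or4P[|||/or3P[]] /eqP[-> -> ->]; rewrite eqxx ?orbT.
- by rewrite mem_head.
Qed.

Lemma exceptional_dec a b c : exceptional a b c \/ ~ exceptional a b c.
Proof.
pose P (t : G * G * G) := let: (x, y, z) := t in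
  [|| (#[x]%g == 4%N) && (8 %| #|G|)%N, (x *+ 2 == y *+ 2) && (8 %| #|G|)%N,
      (#[x]%g == 8%N) && (y == x *+ 3), (#[x]%g == 12%N) && (y == x *+ 4)
    | (#[x]%g == 3%N) && (#[y]%g == 3%N)].
have [/hasP[[[x y] z] xyz Pxyz]|/hasPn noP] := boolP (has P (orderings a b c)).
  left; exists x, y, z; rewrite -mem_orderings; split=> //.
  by case/or4P: Pxyz => [|||/orP[]] /andP[] =>
    [/eqP ? ?|/eqP ? ?|/eqP ? /eqP ?|/eqP ? /eqP ?|/eqP ? /eqP ?]; tauto.
right=> -[x [y [z [pe xyz]]]]; have /noP/negP[] : (x, y, z) \in orderings a b c.
  by rewrite mem_orderings.
by rewrite /P; case: xyz => [[-> ->]|[[-> ->]|[[-> ->]|[[-> ->]|[-> ->]]]]];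
  rewrite ?eqxx ?orbT.
Qed.

(** Involutions are treated first because the cases y = 2x and y = 3x assume nonvanishing
    doubles. *)
Lemma triple_decided a b c : triple a b c -> decided a b c.
Proof.
move=> abc3; have [ex|nex] := exceptional_dec a b c; first by right.
have [/hasP[[[x y] z]]|/hasPn no2] :=
    boolP (has (fun t => t.1.1 *+ 2 == 0) (orderings a b c)).
  rewrite mem_orderings /= => pe /eqP x2; apply: (decided_perm pe).
  exact: decided_2x (triple_perm pe abc3) x2.
pose P (t : G * G * G) := let: (x, y, z) := t in
  [|| x *+ 3 == 0, x *+ 2 == y *+ 2, y == x *+ 2 | y == x *+ 3].
have [/hasP[[[x y] z]]|/hasPn noP] := boolP (has P (orderings a b c)).
  rewrite mem_orderings => pe Pxyz; have xyz3 := triple_perm pe abc3.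
  have neq2 u v w : perm_eq [:: u; v; w] [:: x; y; z] -> u *+ 2 != 0.
    move=> pe'; apply: (no2 (u, v, w)).
    by rewrite mem_orderings (perm_trans pe').
  have x2 := neq2 _ _ _ (perm_refl _); have y2 := neq2 _ _ _ (perm3_bca x y z).
  have z2 := neq2 _ _ _ (perm3_cab x y z).
  apply: (decided_perm pe).
  by case/or4P: Pxyz => /eqP ?;
    [exact: decided_3x|exact: decided_2x_2y|exact: decided_y_2x|exact: decided_y_3x].
left; apply: generic_trivial => // x y z pe.
have xyz : (x, y, z) \in orderings a b c by rewrite mem_orderings.
have /= -> := no2 _ xyz; have /= := noP _ xyz.
by rewrite !negb_or => /and4P[].
Qed.

Lemma cay3E a b c : cay3 a b c =2 fun x y => conn a b c (y - x).
Proof.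
move=> x y; rewrite -conn_opp opprB /cay3 /cay /=.
apply/exists_inP/idP => [[s]|].
  by rewrite !inE -!orbA => sS /eqP->; rewrite addrAC subrr add0r /conn !inE.
move=> xy; exists (x - y); first by rewrite !inE -!orbA; move: xy; rewrite /conn !inE.
by rewrite addrC subrK.
Qed.

Lemma cay3_sym a b c : symmetric (cay3 a b c).
Proof. by move=> x y; rewrite !cay3E -conn_opp opprB. Qed.

Lemma twofold_cay3 a b c f g :
  twofold (cay3 a b c) f g <-> tf (conn a b c) f g.
Proof.
by split=> -[f_inj g_inj fg]; split=> // x y; have := fg x y; rewrite !cay3E.
Qed.

(** The triangle a, b, c changes the layer and the generators reach every vertex, so the double
    cover is connected. *)
Lemma cay3_stable a b c : triple a b c -> tf_trivial (conn a b c) ->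
  stable (cay3 a b c).
Proof.
move=> abc3 tr; apply: twofold_stable => [psi psiE|f g /twofold_cay3/tr //].
have [_ abc _] := abc3.
have psiS x s i : conn a b c s -> psi (x, i) = psi (x + s, ~~ i).
  by move=> Ss; apply: psiE; rewrite cay3E addrAC subrr add0r.
have [Sa Sb Sc] : [/\ conn a b c a, conn a b c b & conn a b c c].
  by rewrite /conn !inE !eqxx ?orbT.
have flip x i : psi (x, i) = psi (x, ~~ i).
  rewrite (psiS x a i) // (psiS (x + a) b) // (psiS (x + a + b) c) // negbK.
  by congr (psi (_, _)); rewrite -[RHS]addr0 -abc !addrA.
suff psi0 x i : psi (x, i) = psi (0, true) by move=> [x i] [y j]; rewrite !psi0.
suff : psi (x, i) = psi (0, i) by move->; case: i => //; rewrite flip.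
move: x i; apply: (S_ind abc3) => // x s Ss IH i.
by rewrite -IH [RHS](psiS x s) // -flip.
Qed.
End Classification.

(** * The exceptional triples *)

Section NontrivialPairs.
Variable G : finZmodType.
Implicit Types (a b c d x y z u v h : G).

Definition tf_nontrivial (S : pred G) :=
  exists f g x, tf S f g /\ f x <> g x.

(* The connection set is invariant under translation by [x - y]. *)
Lemma nontrivial_33 x y z : triple x y z -> #[x]%g = 3%N -> #[y]%g = 3%N ->
  tf_nontrivial (conn x y z).
Proof.
move=> [_ xyz /and5P[xy _ _ _ _]] ox oy.
have x3 : x *+ 3 = 0 by rewrite -ox -FinRing.zmodXgE expg_order.
have y3 : y *+ 3 = 0 by rewrite -oy -FinRing.zmodXgE expg_order.
have zE : z = - x - y by apply: (zlin 1 xyz); zmod.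
pose d := x - y; pose S := conn x y z.
have shift s : S s -> S (s + d).
  rewrite /S /conn !inE zE /d => /or4P[|||/or3P[]] /eqP->.
  - have -> : x + (x - y) = - x - y by apply: (zlin 1 x3); zmod.
    by rewrite eqxx ?orbT.
  - have -> : - x + (x - y) = - y by zmod.
    by rewrite eqxx ?orbT.
  - have -> : y + (x - y) = x by zmod.
    by rewrite eqxx ?orbT.
  - have -> : - y + (x - y) = - (- x - y) by apply: (zlin (-1) y3); zmod.
    by rewrite eqxx ?orbT.
  - have -> : - x - y + (x - y) = y by apply: (zlin (-1) y3); zmod.
    by rewrite eqxx ?orbT.
  - have -> : - (- x - y) + (x - y) = - x by apply: (zlin 1 x3); zmod.
    by rewrite eqxx ?orbT.
exists id, (fun q => q + d), 0; split; last first.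
  by rewrite add0r => /esym/eqP; rewrite subr_eq0 (negbTE xy).
split=> [//|q1 q2 /addIr //|p q]; rewrite addrAC -/S.
apply/idP/idP => [Sqd|]; last exact: shift.
rewrite (_ : q - p = q - p + d + d + d); first exact (shift _ (shift _ Sqd)).
by rewrite /d; apply: (zlin2 (-1) 1 x3 y3); zmod.
Qed.

Lemma card_gen2 u v : gen2 u v -> (#|G| = #[v]%g * ord_mod v u)%N.
Proof.
move=> gen; apply/eqP; rewrite eqn_leq andbC; apply/andP; split.
  by apply: dvdn_leq (ord_mod_dvd v u); apply/card_gt0P; exists 0.
rewrite mulnC -[ord_mod v u]card_ord -[#[v]%g]card_ord -card_prod.
pose F (t : 'I_(ord_mod v u) * 'I_#[v]%g) := u *+ t.1 + v *+ t.2.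
apply: leq_trans (leq_image_card F predT); apply: subset_leq_card.
apply/subsetP => x _; have [i [j [lt_i lt_j ->]]] := gen2_elt x gen.
by apply/imageP; exists (Ordinal lt_i, Ordinal lt_j).
Qed.

(** Modulo [v] the subgroup consists of multiples of [n u], and [n] divides the order of [u] there.
    This keeps small multiples of [u] outside the subgroups K used below. *)
Lemma join_modE u v n (i : int) : (n %| ord_mod v u)%N ->
  u *~ i \in (<[v]> <*> <[u *+ n]>)%g -> (n %| `|i|)%N.
Proof.
move=> n_dvd; have cent : commute <[v]>%g <[u *+ n]>%g.
  exact: centC (sub_abelian_cent2 (FinRing.zmod_abelian setT) (subsetT _) (subsetT _)).
rewrite (comm_joingE cent).
case/mulsgP => w1 w2 /cycleE[j _ ->] /cycleE[k _ ->]; rewrite FinRing.zmodMgE => uE.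
have : u *~ (i - (n * k)%N%:Z) \in <[v]>%g.
  by rewrite mulrzBr uE -pmulrn mulrnA addrK -FinRing.zmodXgE mem_cycle.
rewrite -ord_modzE => /(dvdn_trans n_dvd).
rewrite -[(n %| _)%N]/(n%:Z %| _)%Z => nk.
by rewrite -[(n %| `|i|)%N]/(n%:Z %| i)%Z -(subrK (n * k)%N%:Z i) rpredD // PoszM dvdz_mulr.
Qed.
Section Shift.
Variables (v u : G) (n : nat).
Let K := (<[v]> <*> <[u *+ n]>)%G.

Lemma joinK_v : v \in K.
Proof. by rewrite (subsetP (joing_subl _ _)) ?cycle_id. Qed.

Lemma joinK_u : u *+ n \in K.
Proof. by rewrite (subsetP (joing_subr _ _)) ?cycle_id. Qed.

Lemma joinKD g h : h \in K -> (g + h \in K) = (g \in K).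
Proof. by move=> hK; rewrite -FinRing.zmodMgE groupMr. Qed.

Lemma joinKN g : (- g \in K) = (g \in K).
Proof. by rewrite -FinRing.zmodVgE groupV. Qed.

Lemma joinKM h k : h \in K -> h *+ k \in K.
Proof. by move=> hK; rewrite -FinRing.zmodXgE groupX. Qed.
End Shift.

(* With [e = 2 x] and a subgroup [K] of index 2 containing [x] and not [y], the
   pair is [f = p + e 1_(p \notin K)], [g = f + e]. *)
Lemma nontrivial_4 x y z : triple x y z -> #[x]%g = 4%N -> (8 %| #|G|)%N ->
  tf_nontrivial (conn x y z).
Proof.
move=> [gen xyz neqs] ox G8.
have gen' : gen2 y x by move=> g; have [i [j ->]] := gen g; exists j, i; rewrite addrC.
have o2 : (2 %| ord_mod x y)%N.
  by move: G8; rewrite (card_gen2 gen') ox -[8%N]/(4 * 2)%N dvdn_pmul2l.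
pose K := (<[x]> <*> <[y *+ 2]>)%G.
have xK : x \in K := joinK_v x y 2.
have y2K : y *+ 2 \in K := joinK_u x y 2.
have yK : y \notin K by apply/negP => /(join_modE (i := 1) o2).
have zE : z = - x - y by apply: (zlin 1 xyz); zmod.
have zK : z \notin K by rewrite zE addrC joinKD ?joinKN.
have split_K g : g \in K \/ g - y \in K.
  have [i [j [_ _ ->]]] := gen2_elt g gen'.
  have jK : x *+ j \in K by exact: joinKM.
  have hK k : y *+ (2 * k)%N \in K by rewrite mulrnA joinKM.
  rewrite joinKD // addrAC joinKD // -[i]odd_double_half -mul2n.
  case: (odd i); last by left; rewrite add0n.
  by right; rewrite mulrnDr addrAC subrr add0r.
pose e := x *+ 2; have x4 : x *+ 4 = 0 by rewrite -ox -FinRing.zmodXgE expg_order.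
have eK : e \in K by exact: joinKM.
have e0 : e != 0.
  by apply/negP; rewrite -dvdn_orderE ox.
have e2 : e + e = 0 by rewrite -mulr2n -mulrnA.
pose f p := if p \in K then p else p + e.
have fK p : (f p \in K) = (p \in K) by rewrite /f; case: ifP => pK; rewrite ?joinKD.
have f_inj : injective f.
  move=> p q fpq; have := fK p; rewrite fpq fK; move: fpq; rewrite /f => + pqK.
  by rewrite pqK; case: ifP => // _ /addIr.
exists f, (fun q => f q + e), 0; split; last first.
  by rewrite -[LHS]addr0 => /addrI/esym/eqP; rewrite (negbTE e0).
split=> // [q1 q2 /addIr/f_inj //|p q].
(* Only [x] and [-x] of the connection set lie in [K], and translation by [e = 2 x] exchanges
   them. *)
have shift d : d \in K -> conn x y z (d + e) = conn x y z d.
  have shift1 h : h \in K -> conn x y z h -> conn x y z (h + e).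
    move=> hK; rewrite {1}/conn !inE => /or4P[|||/or3P[]] /eqP hE; move: hK.
    - have -> : h + e = - x by rewrite hE; apply: (zlin 1 x4); rewrite /e; zmod.
      by rewrite /conn !inE eqxx orbT.
    - have -> : h + e = x by rewrite hE /e; zmod.
      by rewrite /conn !inE eqxx.
    - by rewrite hE (negbTE yK).
    - by rewrite hE joinKN (negbTE yK).
    - by rewrite hE (negbTE zK).
    - by rewrite hE joinKN (negbTE zK).
  move=> dK; apply/idP/idP => [Sde|]; last exact: shift1.
  by rewrite -[d]addr0 -e2 addrA; apply: shift1; rewrite ?joinKD.
have pqK : (q - p \in K) = ((p \in K) == (q \in K)).
  have [pK|pK] := boolP (p \in K); first by rewrite joinKD ?joinKN.
  have [qK|qK] := boolP (q \in K).
    by rewrite addrC joinKD // joinKN (negbTE pK).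
  have [//|pyK] := split_K p; first by rewrite (negbTE pK).
  have [//|qyK] := split_K q; first by rewrite (negbTE qK).
  have -> : q - p = (q - y) - (p - y) by zmod.
  by rewrite joinKD ?joinKN.
(* If [p] and [q] are on the same side of [K], the difference lies in [K] and changes by [e];
   otherwise it changes by 0 or [2 e = 0]. *)
rewrite /f; case: ifP => qK; case: ifP => pK; move: pqK; rewrite qK pK /= => pqK.
- by rewrite addrAC shift.
- by rewrite opprD addrA addrAC addrK.
- by rewrite -[q + e + e]addrA e2 addr0.
- by rewrite -[RHS]shift //; congr (conn _ _ _ _); zmod.
Qed.

(* With [d = y - x], the pair translates by [d] the subgroup [K = <d, 4 x>] in one
   layer and the coset [K - z] in the other. *)
Lemma nontrivial_22 x y z : triple x y z -> x *+ 2 = y *+ 2 -> (8 %| #|G|)%N ->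
  tf_nontrivial (conn x y z).
Proof.
move=> [gen xyz /and5P[xy _ _ _ _]] xy2 G8.
have [d yE] : exists d, y = x + d by exists (y - x); rewrite addrC subrK.
have d2 : d *+ 2 = 0 by apply: (zlin (-1) xy2); rewrite yE; zmod.
have d0 : d != 0 by apply: contraNneq xy; rewrite yE => ->; rewrite addr0.
have gen' : gen2 x d.
  move=> g; have [i [j ->]] := gen g; exists (i + j), j.
  by rewrite yE mulrzDl mulrzDr addrA.
have o4 : (4 %| ord_mod d x)%N.
  by move: G8; rewrite (card_gen2 gen') order_2 // -[8%N]/(2 * 4)%N dvdn_pmul2l.
pose K := (<[d]> <*> <[x *+ 4]>)%G.
have dK : d \in K := joinK_v d x 4.
have x4K : x *+ 4 \in K := joinK_u d x 4.
have zE : z = - (x *+ 2) + d.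
  by rewrite yE in xyz; apply: (zlin2 1 (-1) xyz d2); zmod.
have zK : z \notin K.
  rewrite zE joinKD // joinKN; apply/negP => x2K.
  by have := join_modE (i := 2) o4 x2K.
have z2K : z + z \in K.
  have -> : z + z = - (x *+ 4) by rewrite zE; apply: (zlin 1 d2); zmod.
  by rewrite joinKN.
have dd : d + d = 0 by rewrite -mulr2n.
pose t w p := if p + w \in K then p + d else p.
have tK w p : (t w p + w \in K) = (p + w \in K).
  by rewrite /t; case: ifP => pK; rewrite // addrAC joinKD.
have t_inj w : injective (t w).
  move=> p q tpq; have := tK w p; rewrite tpq tK; move: tpq; rewrite /t => + pqK.
  by rewrite pqK; case: ifP => // _ /addIr.
exists (t 0), (t z), 0; split; last first.
  rewrite /t !add0r (negbTE zK) group1 => /eqP.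
  by rewrite (negbTE d0).
split=> // p q.
(* Translation by [d] permutes x, -x, y, -y, while [z] and [-z] are excluded because [2 z] and 0 lie
   in [K]. The difference [q - p] changes by [d] only if exactly one of [p], [q + z] is in [K], and
   then [q - p + z] is not. *)
have shift h : h + z \notin K -> conn x y z h -> conn x y z (h + d).
  move=> hK; rewrite {1}/conn !inE => /or4P[|||/or3P[]] /eqP hE; move: hK.
  - by rewrite hE -yE /conn !inE eqxx ?orbT.
  - have -> : h + d = - y by rewrite hE yE; apply: (zlin 1 d2); zmod.
    by rewrite /conn !inE eqxx ?orbT.
  - have -> : h + d = x by rewrite hE yE; apply: (zlin 1 d2); zmod.
    by rewrite /conn !inE eqxx ?orbT.
  - have -> : h + d = - x by rewrite hE yE; zmod.
    by rewrite /conn !inE eqxx ?orbT.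
  - by rewrite hE z2K.
  - by rewrite hE addNr group1.
have shiftE h : h + z \notin K -> conn x y z (h + d) = conn x y z h.
  move=> hK; apply/idP/idP => [Sh|]; last exact: shift.
  rewrite -[h]addr0 -dd addrA; apply: shift => //.
  by rewrite addrAC joinKD.
rewrite /t addr0; case: ifP => qK; case: ifP => pK.
- by congr (conn _ _ _ _); zmod.
- rewrite addrAC shiftE //; apply/negP => qpK; case/negP: (negbT pK).
  have -> : p = (q + z) - (q - p + z) by zmod.
  by rewrite joinKD ?joinKN.
- have -> : q - (p + d) = q - p + d by apply: (zlin (-1) d2); zmod.
  rewrite shiftE //; apply/negP => qpK; case/negP: (negbT qK).
  have -> : q + z = (q - p + z) + p by zmod.
  by rewrite joinKD.
- by [].
Qed.

(** The tables [F] and [H] list the exponents of the images under the two permutations, which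
    reduces the conditions to a finite computation. *)
Lemma nontrivial_cyclic x n L (F H : seq nat) (S : pred G) :
  #[x]%g = n -> (forall g, g \in <[x]>%g) -> S =1 den x 0 L ->
  let D i j := has (veq (rel_grid n 1) ((j : int) - (i : int), 0)) L in
  let ns := iota 0 n in
  [&& perm_eq F ns, perm_eq H ns, has (fun i => nth 0 F i != nth 0 H i) ns &
      all (fun i => all (fun j => D (nth 0 F i) (nth 0 H j) == D i j) ns) ns]%N ->
  tf_nontrivial S.
Proof.
move=> ox genx SE D ns /and4P[F_perm H_perm /hasP[i0 i0n FH] /allP D_ok].
pose idx g := index g [seq x *+ i | i <- ns].
have idxK g : x *+ idx g = g /\ (idx g < n)%N.
  have gx : g \in [seq x *+ i | i <- ns].
    have /cycleE[i lt_i ->] := genx g.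
    by apply/mapP; exists i; rewrite // mem_iota -ox.
  have lt_idx : (idx g < n)%N by rewrite -index_mem size_map size_iota in gx.
  split=> //; have := nth_index 0 gx.
  by rewrite (nth_map 0%N) ?size_iota // nth_iota.
have perm_lt (E : seq nat) i : perm_eq E ns -> (i < n)%N -> (nth 0 E i < n)%N.
  move=> E_perm lt_i; have /perm_mem/(_ (nth 0%N E i)) := E_perm.
  by rewrite mem_nth ?(perm_size E_perm) ?size_iota // mem_iota => /esym/andP[].
have xinj i j : (i < n)%N -> (j < n)%N -> x *+ i = x *+ j -> i = j.
  move=> lt_i lt_j; wlog le_ij : i j lt_i lt_j / (i <= j)%N => [hw ij|].
    by have [/hw->|/ltnW/hw->] := leqP i j.
  rewrite -(subnKC le_ij) mulrnDr -{1}[x *+ i]addr0 => /addrI/esym/eqP.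
  rewrite -dvdn_orderE ox => /dvdnP[[|k] kE]; first by rewrite kE addn0.
  by move: lt_j; rewrite -(subnKC le_ij) kE mulSn addnCA ltnNge leq_addr.
have act_inj (E : seq nat) : perm_eq E ns -> injective (fun g => x *+ nth 0%N E (idx g)).
  move=> E_perm g h; have [gE lt_g] := idxK g; have [hE lt_h] := idxK h.
  move/xinj => /(_ (perm_lt _ _ E_perm lt_g) (perm_lt _ _ E_perm lt_h)) /eqP.
  rewrite nth_uniq ?(perm_size E_perm) ?size_iota ?(perm_uniq E_perm) ?iota_uniq //.
  by move/eqP => gh; rewrite -gE gh hE.
have S_D i j : S (x *+ j - x *+ i) = D i j.
  rewrite SE /D (veq_has (rel_gridP1 (erefl (0 : G)) ox)); last first.
    by apply/allP.
  by rewrite /den /mu /= mul0rz addr0 mulrzBr.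
exists (fun g => x *+ nth 0%N F (idx g)), (fun g => x *+ nth 0%N H (idx g)).
exists (x *+ i0); rewrite mem_iota in i0n.
have idxE i : (i < n)%N -> idx (x *+ i) = i.
  by move=> lt_i; have [iE lt_idx] := idxK (x *+ i); exact: xinj.
split; last by rewrite idxE // => /xinj FHE; case/eqP: FH; rewrite FHE ?perm_lt.
split; [exact: act_inj|exact: act_inj|move=> g h].
have [gE lt_g] := idxK g; have [hE lt_h] := idxK h.
have gn : idx g \in ns by rewrite mem_iota.
have hn : idx h \in ns by rewrite mem_iota.
have /allP D_g := D_ok _ gn; have /eqP D_gh := D_g _ hn.
by rewrite -[in RHS]gE -[in RHS]hE !S_D.
Qed.

(** In Z/8 the connection set consists of the odd residues and 4, so 0 and 2 differ only in their
    neighbours 4 and 6. The pair exchanges 0 with 2 in one layer and 4 with 6 in the other. *)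
Lemma nontrivial_8 x y z : triple x y z -> #[x]%g = 8%N -> y = x *+ 3 ->
  tf_nontrivial (conn x y z).
Proof.
move=> [gen xyz _] ox yE.
have zE : z = - (x *+ 4) by rewrite yE in xyz; apply: (zlin 1 xyz); zmod.
apply: (nontrivial_cyclic (L := cyc_list [:: 1; -1; 3; -3; -4; 4])
  (F := [:: 2; 1; 0; 3; 4; 5; 6; 7]) (H := [:: 0; 1; 2; 3; 6; 5; 4; 7]) ox).
- by move=> g; have [i [j ->]] := gen g; rewrite yE pmulrn -mulrzA -mulrzDr mem_cyclez.
- move=> g; rewrite /conn /den yE zE; congr (_ \in _); rewrite /= /mu /=.
  by do 6?[congr (_ :: _)]; zmod.
- by vm_compute.
Qed.

(* In Z/12 = Z/4 x Z/3 the connection set is {0, 1, 3} x {1, 2}; exchanging two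
   residues mod 4 in one layer is compensated by exchanging their antipodes in
   the other. *)
Lemma nontrivial_12 x y z : triple x y z -> #[x]%g = 12%N -> y = x *+ 4 ->
  tf_nontrivial (conn x y z).
Proof.
move=> [gen xyz _] ox yE.
have zE : z = - (x *+ 5) by rewrite yE in xyz; apply: (zlin 1 xyz); zmod.
(* [F] exchanges the residues 0 and 1 modulo 4, [H] the residues 2 and 3; both preserve residues
   modulo 3. *)
apply: (nontrivial_cyclic (L := cyc_list [:: 1; -1; 4; -4; -5; 5])
  (F := [:: 9; 4; 2; 3; 1; 8; 6; 7; 5; 0; 10; 11])
  (H := [:: 0; 1; 11; 6; 4; 5; 3; 10; 8; 9; 7; 2]) ox).
- by move=> g; have [i [j ->]] := gen g; rewrite yE pmulrn -mulrzA -mulrzDr mem_cyclez.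
- move=> g; rewrite /conn /den yE zE; congr (_ \in _); rewrite /= /mu /=.
  by do 6?[congr (_ :: _)]; zmod.
- by vm_compute.
Qed.

Lemma exceptional_nontrivial a b c : triple a b c -> exceptional a b c ->
  tf_nontrivial (conn a b c).
Proof.
move=> abc3 [x [y [z [pe xyz]]]]; have xyz3 := triple_perm pe abc3.
have [f [g [w [fg fgw]]]] : tf_nontrivial (conn x y z).
  case: xyz => [[]|[[]|[[]|[[]|[]]]]].
  - exact: nontrivial_4.
  - exact: nontrivial_22.
  - exact: nontrivial_8.
  - exact: nontrivial_12.
  - exact: nontrivial_33.
exists f, g, w; split=> //; have [f_inj g_inj fgE] := fg.
by split=> // u v; rewrite -!(conn_perm pe).
Qed.

End NontrivialPairs.

(** * From generating sets to triples, and the theorem *)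

Lemma gen2_of_generated (G : finZmodType) (a b c : G) :
  <<[set a; b; c]>>%g = [set: G] -> a + b + c = 0 -> gen2 a b.
Proof.
move=> gen abc x.
have cent : commute <[a]>%g <[b]>%g.
  exact: centC (sub_abelian_cent2 (FinRing.zmod_abelian setT) (subsetT _) (subsetT _)).
have : x \in (<[a]> <*> <[b]>)%g.
  have aK : a \in (<[a]> <*> <[b]>)%g by rewrite (subsetP (joing_subl _ _)) ?cycle_id.
  have bK : b \in (<[a]> <*> <[b]>)%g by rewrite (subsetP (joing_subr _ _)) ?cycle_id.
  have : x \in <<[set a; b; c]>>%g by rewrite gen.
  apply/subsetP; rewrite gen_subG; apply/subsetP => y.
  rewrite !inE -orbA => /or3P[] /eqP-> //.
  have -> : c = ((a * b)^-1)%g.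
    by rewrite FinRing.zmodVgE FinRing.zmodMgE; apply: (zlin 1 abc); zmod.
  by rewrite groupV groupM.
rewrite (comm_joingE cent) => /mulsgP[_ _ /cycleE[i _ ->] /cycleE[j _ ->] ->].
by exists i, j; rewrite FinRing.zmodMgE.
Qed.

Lemma neq_pm (G : finZmodType) (a b : G) :
  [set a; - a] != [set b; - b] -> (a != b) && (a != - b).
Proof.
apply: contraNT; rewrite negb_and !negbK => /orP[] /eqP-> //.
by rewrite opprK setUC.
Qed.

Theorem theorem4p1 (G : finZmodType) (a b c : G)
    (hgen : <<[set a; b; c]>>%g = [set: G])
    (habc : a + b + c = 0)
    (hab : [set a; - a] != [set b; - b])
    (hbc : [set b; - b] != [set c; - c])
    (hac : [set a; - a] != [set c; - c]) :
  unstable (cay3 a b c) <->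
  exists x y z : G, perm_eq [:: x; y; z] [:: a; b; c] /\
    (   (#[x]%g = 4)%N /\ (8 %| #|G|)%N
     \/ x *+ 2 = y *+ 2 /\ (8 %| #|G|)%N
     \/ (#[x]%g = 8)%N /\ y = x *+ 3
     \/ (#[x]%g = 12)%N /\ y = x *+ 4
     \/ (#[x]%g = 3)%N /\ (#[y]%g = 3)%N).
Proof.
have abc3 : triple a b c.
  split=> //; first exact: gen2_of_generated hgen habc.
  have /andP[-> ->] := neq_pm hab; have /andP[-> ->] := neq_pm hbc.
  by have /andP[-> ->] := neq_pm hac.
split=> [unst|/(exceptional_nontrivial abc3)[f [g [x [fg fgx]]]]].
  have [tr|//] := triple_decided abc3.
  by rewrite /unstable (cay3_stable abc3 tr) in unst.
apply/negP => st; apply: fgx; apply: (stable_twofold (@cay3_sym _ a b c) st).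
exact/twofold_cay3.
Qed.
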